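(* Let $n\geq 3$ be an integer and let $\varepsilon>0$. Suppose that $B_1,\ldots,B_n\geq 1$ and a form $F(\mathbf{x})\in\mathbb{Z}[x_1,\ldots,x_n]$ of degree $d$, irreducible over $\mathbb{Q}$, are given. Then there exist $D$ depending only on $n$, $d$ and $\varepsilon$, and an integer $k$ satisfying $$k\ll_{n,d,\varepsilon}\left(V^d/T\right)^{d^{-(n-1)/(n-2)}}V^{\varepsilon}\,(\log\|F\|)^{2n-3}$$ (with implied constant depending only on $n,d,\varepsilon$), with the following properties. For each $j\leq k$ there is an integral form $F_j(\mathbf{x})$ in $n$ variables, having degree at most $D$, such that 1. $F(\mathbf{x})\nmid F_j(\mathbf{x})$ for $1\leq j\leq k$; 2. for every $\mathbf{x}\in Z_n$ with $F(\mathbf{x})=0$ and $|x_i|\leq B_i$ $(1\leq i\leq n)$, there is an integer $j\leq k$ such that $F_j(\mathbf{x})=0$.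
   Context: $Z_n$ denotes the set of all nonzero $\mathbf{x}=(x_1,\ldots,x_n)\in\mathbb{Z}^n$ with $\gcd(x_1,\ldots,x_n)=1$ and such that $x_i>0$ for the smallest index $i$ with $x_i\neq 0$. Put $V=\prod_{i=1}^n B_i$ and $$T=\max\Big\{\prod_{i=1}^nB_i^{f_i}\Big\},$$ the maximum being taken over all integer $n$-tuples $(f_1,\ldots,f_n)$ for which the monomial $x_1^{f_1}\cdots x_n^{f_n}$ occurs in $F(\mathbf{x})$ with nonzero coefficient. $\|F\|$ denotes the maximum modulus of the coefficients of $F$.
   Formalization: The factor log‖F‖ is read as max(1, log‖F‖), since for ‖F‖=1 the stated bound would force k=0, which fails for F=x_1, n=3, B_i=1 and the zero (0,1,0); for ‖F‖≥2 the two bounds agree up to a constant depending only on n. *)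

(* Defs.v *)
From mathcomp Require Import all_boot all_order all_algebra.
From mathcomp Require Import reals.
From mathcomp Require Import mpoly.
From mathcomp Require Import exp.

Set Implicit Arguments.
Unset Strict Implicit.
Unset Printing Implicit Defensive.

Import Order.TTheory GRing.Theory Num.Theory.
Local Open Scope ring_scope.

Definition irreducible_elt (A : unitRingType) (p : A) : Prop :=
  [/\ p != 0, p \isn't a GRing.unit
    & forall q r : A, p = q * r ->
        q \is a GRing.unit \/ r \is a GRing.unit].

Definition ring_dvd (A : comNzRingType) (p q : A) : Prop :=
  exists r : A, q = r * p.

Definition toQ (n : nat) (F : {mpoly int[n]}) : {mpoly rat[n]} :=
  map_mpoly (intr : int -> rat) F.

(* For an integral F that is not assumed primitive but only irreducible over Q,
   "F divides G" is divisibility in Q[x_1, ..., x_n].  Non-divisibility over Q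
   implies non-divisibility over Z; the converse fails for F = 2 x_1,
   G = x_1. *)
Definition dvdQ (n : nat) (F G : {mpoly int[n]}) : Prop :=
  ring_dvd (toQ F) (toQ G).

Definition Zprim (n : nat) (x : 'I_n -> int) : Prop :=
  [/\ exists i, x i != 0,
      \big[gcdz/0]_(i < n) x i = 1
    & forall i, x i != 0 -> (forall j : 'I_n, (j < i)%N -> x j = 0) -> 0 < x i].

Definition mpoly_norm (n : nat) (F : {mpoly int[n]}) : nat :=
  (\max_(m <- msupp F) `|F@_m|%N)%N.

Definition boxV (R : realType) (n : nat) (B : 'I_n -> R) : R :=
  \prod_(i < n) B i.

(* Every B i is positive in use, so the default value 0 is never the maximum
   unless F = 0. *)
Definition boxT (R : realType) (n : nat) (B : 'I_n -> R)
    (F : {mpoly int[n]}) : R :=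
  \big[Num.max/0]_(m <- msupp F) \prod_(i < n) B i ^+ m i.

(* The factor log ||F|| of an upper bound, with the usual convention that such
   a factor is at least 1: for ||F|| >= 2 this changes log ||F|| by at most a
   constant factor, while for ||F|| = 1 the factor log 1 = 0 would make every
   bound containing it vanish. *)
Definition log_norm (R : realType) (n : nat) (F : {mpoly int[n]}) : R :=
  Num.max 1 (ln (mpoly_norm F)%:R).

(* Main.v *)
Require Import Defs.
From mathcomp Require Import all_boot all_order all_algebra.
From mathcomp Require Import reals.
From mathcomp Require Import mpoly.
From mathcomp Require Import exp.
From mathcomp Require Import ring lra zify.

(* A point x with F(x) = 0 either has all partial derivatives of F equal to 0,
   and then lies on a form dF/dx_i that F does not divide, or some dF/dx_i(x)
   is nonzero. In the second case some prime p out of r given ones does not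
   divide dF/dx_i(x), provided 2^r exceeds this value, so that
   r << V^eps log ||F||. The points whose reduction mod p is a given
   nonsingular point t of the hypersurface are covered by a single auxiliary
   form G, and there are O(p^(n-2)) such t.

   The form G is found by a pigeonhole argument in place of a determinant.
   Normalise x_i0 = 1; by Hensel's lemma a further coordinate x_i1 is, modulo
   p^m, a polynomial in the other n - 2 coordinates. Writing these as
   t_j + p z_j, one has
   G(x) = sum_a p^|a| h_a(G) z^a modulo p^m, so that p^m divides G(x) as soon
   as p^(m - |a|) divides h_a(G) for |a| < m, which is a sublattice of index at
   most p^C(m+n-2, n-1) in the space of coefficients of G. If the coefficient of
   each monomial M is bounded by p^m / (2 s M(B)), where s is the number of
   monomials allowed, then |G(x)| < p^m and therefore G(x) = 0. Allowing exactly
   the monomials of degree D + d that are not divisible by a monomial of F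
   realising T ensures that F does not divide G, and choosing m close to
   d^(1/(n-2)) D balances the two sides. *)

Set Implicit Arguments.
Unset Strict Implicit.
Unset Printing Implicit Defensive.

Import Order.TTheory GRing.Theory Num.Theory.
Local Open Scope ring_scope.

(** * Integer solutions of systems of congruences *)

(** Pigeonhole: the box 0 <= u_i <= K_i has more points than there are vectors of residues, so two
    of its points share all residues, and their difference is the solution. *)
Lemma siegel_lattice (I J : finType) (K : I -> nat) (q : J -> nat)
    (A : J -> I -> int) :
  (forall j, 0 < q j)%N -> (\prod_j q j < \prod_i (K i).+1)%N ->
  exists c : I -> int,
    [/\ exists i, c i != 0, forall i, (`|c i| <= K i)%N
      & forall j, ((q j)%:Z %| \sum_i A j i * c i)%Z].
Proof.
move=> q_gt0 lt_qK.
pose S (u : {dffun forall i, 'I_(K i).+1}) j := \sum_i A j i * (u i : nat)%:Z.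
have ltS u j : (`|(S u j %% (q j)%:Z)%Z| < q j)%N.
  have q0 : (q j)%:Z != 0 by rewrite eqz_nat -lt0n q_gt0.
  by rewrite -ltz_nat gez0_abs ?modz_ge0 // ltz_mod.
pose f (u : {dffun forall i, 'I_(K i).+1}) : {dffun forall j, 'I_(q j)} :=
  [ffun j => Ordinal (ltS u j)].
have /injectivePn[u [v neq_uv fuv]] : ~~ injectiveb f.
  apply/negP => /injectiveP /leq_card; rewrite !card_dep_ffun.
  have E (L : finType) (k : L -> nat) :
      foldr muln 1%N [seq #|'I_(k x)| | x : L] = (\prod_x k x)%N.
    rewrite foldrE big_map -big_enum; apply: eq_bigr => x _; exact: card_ord.
  by rewrite !E leqNgt lt_qK.
exists (fun i => (u i : nat)%:Z - (v i : nat)%:Z); split.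
- have [i neq_i|eq_uv] := pickP (fun i => u i != v i).
    by exists i; rewrite subr_eq0 eqz_nat.
  case/eqP: neq_uv; apply/ffunP => i; apply/eqP; apply: negbFE; exact: eq_uv.
- move=> i; have := ltn_ord (u i); have := ltn_ord (v i).
  rewrite !ltnS => vK uK; case: (leqP (u i) (v i)) => [le_uv|/ltnW le_vu].
    by rewrite distnEr // (leq_trans (leq_subr _ _)).
  by rewrite distnEl // (leq_trans (leq_subr _ _)).
- move=> j; have /ffunP/(_ j)/(congr1 val) := fuv.
  rewrite !ffunE /= => eq_mod.
  under eq_bigr do rewrite mulrBr.
  rewrite sumrB -/(S u j) -/(S v j) -eqz_mod_dvd.
  have q0 : (q j)%:Z != 0 by rewrite eqz_nat -lt0n q_gt0.
  by apply/eqP; rewrite -[LHS]gez0_abs ?modz_ge0 // eq_mod gez0_abs ?modz_ge0.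
Qed.

(** * Polynomials in several variables *)

Lemma meval_dhomog (R : comNzRingType) (n d : nat) (F : {mpoly R[n]})
    (u : R) (x : 'I_n -> R) :
  F \is d.-homog -> F.@[fun i => u * x i] = u ^+ d * F.@[x].
Proof.
move=> /dhomogP Fd; rewrite !mevalE mulr_sumr big_seq [RHS]big_seq.
apply: eq_bigr => m /Fd <-.
under eq_bigr do rewrite exprMn.
by rewrite big_split /= prodrXr mdegE mulrCA.
Qed.

Lemma mderiv_dhomog (R : nzRingType) (n d : nat) (F : {mpoly R[n]}) (i : 'I_n) :
  F \is d.+1.-homog -> F^`M(i) \is d.-homog.
Proof.
move=> /dhomogP Fd; apply/dhomogP => m; rewrite mcoeff_msupp mcoeff_mderiv => nz.
have /Fd : (m + U_(i))%MM \in msupp F.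
  by rewrite mcoeff_msupp; apply: contraNneq nz => ->; rewrite mul0rn.
by rewrite /= mdegD mdeg1 addn1 => -[].
Qed.

Lemma euler_dhomog (R : comNzRingType) (n d : nat) (F : {mpoly R[n]})
    (x : 'I_n -> R) :
  F \is d.-homog -> \sum_i x i * F^`M(i).@[x] = d%:R * F.@[x].
Proof.
move=> /dhomogP Fd.
have LE m : \sum_i x i * (('X_[R, m])^`M(i)).@[x]
    = (mdeg m)%:R * \prod_i x i ^+ m i.
  rewrite mdegE natr_sum mulr_suml; apply: eq_bigr => i _.
  rewrite mderivX mevalZ mulrCA mevalX.
  (* For m_i = 0 the truncated exponent [m - U_(i)] is not the true one, but both sides carry the
     factor m_i. *)
  have [mi0|mi_gt0] := posnP (m i); first by rewrite mi0 !mul0r.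
  congr (_ * _); rewrite (bigD1 i) //= [RHS](bigD1 i) //= mulrA.
  rewrite mnmBE mnm1E eqxx -exprS subn1 prednK //; congr (_ * _).
  apply: eq_bigr => j ne_ji; rewrite mnmBE mnm1E.
  by rewrite eq_sym (negPf ne_ji) subn0.
rewrite mevalE [F in LHS]mpolyE mulr_sumr.
transitivity (\sum_(m <- msupp F) F@_m *
    \sum_i x i * (('X_[R, m])^`M(i)).@[x]).
  transitivity (\sum_i \sum_(m <- msupp F) x i * (F@_m * ('X_[R, m])^`M(i).@[x])).
    apply: eq_bigr => i _; rewrite (linear_sum (mderiv i)) /=.
    rewrite (raddf_sum (meval x)) mulr_sumr /=.
    by apply: eq_bigr => m _; rewrite mderivZ mevalZ.
  rewrite exchange_big; apply: eq_bigr => m _; rewrite mulr_sumr.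
  by apply: eq_bigr => i _; rewrite mulrCA.
rewrite big_seq [RHS]big_seq; apply: eq_bigr => m /Fd /= <-.
by rewrite LE mulrCA.
Qed.

Lemma meval_cong (n : nat) (F : {mpoly int[n]}) (q : int) (x y : 'I_n -> int) :
  (forall i, (q %| x i - y i)%Z) -> (q %| F.@[x] - F.@[y])%Z.
Proof.
move=> xy; rewrite !mevalE -sumrB; apply: rpred_sum => m _.
rewrite -mulrBr dvdz_mull //.
apply: (big_ind2 (fun a b => (q %| a - b)%Z)).
- by rewrite subrr dvdz0.
- move=> a b c d ab cd.
  have -> : a * c - b * d = (a - b) * c + b * (c - d) by ring.
  by apply: rpredD; [exact: dvdz_mulr|exact: dvdz_mull].
- move=> i _; elim: (m i) => [|k IHk]; first by rewrite !expr0 subrr dvdz0.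
  have -> : x i ^+ k.+1 - y i ^+ k.+1
      = (x i - y i) * x i ^+ k + y i * (x i ^+ k - y i ^+ k).
    by rewrite !exprS; ring.
  by apply: rpredD; [exact: dvdz_mulr|exact: dvdz_mull].
Qed.

(** The restriction of [F] to the line through [y] parallel to the axis [i], as a univariate
    polynomial: Taylor expansion and root counting apply to it. *)
Definition slice (R : comNzRingType) (n : nat) (i : 'I_n) (y : 'I_n -> R)
    (F : {mpoly R[n]}) : {poly R} :=
  mmap (@polyC R) (fun j => if j == i then 'X else (y j)%:P) F.

Definition upd (R : Type) (n : nat) (i : 'I_n) (y : 'I_n -> R) (a : R) :=
  fun j => if j == i then a else y j.

Lemma slice_sum (R : comNzRingType) (n : nat) (i : 'I_n) (y : 'I_n -> R)
    (F : {mpoly R[n]}) :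
  slice i y F = \sum_(m <- msupp F)
    (F@_m * \prod_(j < n | j != i) y j ^+ m j)%:P * 'X^(m i).
Proof.
apply: eq_bigr => m _; rewrite /mmap1 (bigD1 i) //= eqxx polyCM -mulrA.
congr (_ * _); rewrite mulrC; congr (_ * _); rewrite rmorph_prod.
by apply: eq_bigr => j /negPf ->; rewrite rmorphXn.
Qed.

Lemma sliceX (R : comNzRingType) (n : nat) (i : 'I_n) (y : 'I_n -> R) m :
  slice i y 'X_[m] = (\prod_(j < n | j != i) y j ^+ m j)%:P * 'X^(m i).
Proof. by rewrite slice_sum msuppX big_seq1 mcoeffX eqxx mul1r. Qed.

Lemma horner_slice (R : comNzRingType) (n : nat) (i : 'I_n) (y : 'I_n -> R)
    (F : {mpoly R[n]}) (a : R) :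
  (slice i y F).[a] = F.@[upd i y a].
Proof.
rewrite slice_sum mevalE horner_sum; apply: eq_bigr => m _.
rewrite !hornerE -mulrA [X in _ = _ * X](bigD1 i) //= /upd eqxx.
congr (_ * _); rewrite mulrC; congr (_ * _).
by apply: eq_bigr => j /negPf ->.
Qed.

Lemma deriv_slice (R : comNzRingType) (n : nat) (i : 'I_n) (y : 'I_n -> R)
    (F : {mpoly R[n]}) :
  (slice i y F)^`() = slice i y F^`M(i).
Proof.
have -> : slice i y F^`M(i)
    = \sum_(m <- msupp F) slice i y (F@_m *: 'X_[m])^`M(i).
  by rewrite {1}[F]mpolyE (linear_sum (mderiv i)) /slice raddf_sum.
rewrite slice_sum linear_sum /=; apply: eq_bigr => m _.
rewrite mderivZ mderivX /slice !mmapZ -/(slice _ _ _) sliceX.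
rewrite deriv_mulC derivXn polyCM -!mulrA; congr (_ * _).
have -> : \prod_(j < n | j != i) y j ^+ (m - U_(i))%MM j
    = \prod_(j < n | j != i) y j ^+ m j.
  by apply: eq_bigr => j ne_ji; rewrite mnmBE mnm1E eq_sym (negPf ne_ji) subn0.
rewrite mnmBE mnm1E eqxx subn1. by rewrite rmorph_nat -(mulr_natr 'X^_); ring.
Qed.

Lemma size_slice (R : comNzRingType) (n d : nat) (i : 'I_n) (y : 'I_n -> R)
    (F : {mpoly R[n]}) :
  F \is d.-homog -> (size (slice i y F) <= d.+1)%N.
Proof.
move=> /dhomogP Fd; rewrite slice_sum big_seq.
apply: (leq_trans (size_sum _ _ _)); apply/bigmax_leqP_seq => m _ mF.
rewrite mul_polyC (leq_trans (size_scale_leq _ _)) // size_polyXn ltnS.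
by rewrite -(Fd m mF) /= mdegE (bigD1 i) //= leq_addr.
Qed.

Lemma horner_taylor2 (R : comNzRingType) (p : {poly R}) (x h : R) :
  exists k, p.[x + h] = p.[x] + p^`().[x] * h + h ^+ 2 * k.
Proof.
exists (\sum_(i < size p) p^`N(i.+2).[x] * h ^+ i).
(* Two terms beyond the size of [p] are allowed, so that the constant and linear terms can be split
   off even when [p] is short. *)
rewrite (nderiv_taylor_wide (n := (size p).+2)) ?(leqW (leqnSn _)) //; last first.
  exact: mulrC.
rewrite !big_ord_recl /= nderivn0 poly.nderivn1 expr0 mulr1 expr1 addrA; congr (_ + _).
rewrite mulr_sumr; apply: eq_bigr => i _.
by rewrite /bump /= !add1n [RHS]mulrCA -exprD add2n.
Qed.

(** * Hensel's lemma *)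

(** A pair of distinct indices i0, i1 is encoded by [i0] and [k] with i1 = [lift i0 k]; [emb]
    enumerates the remaining ones, the free coordinates. *)
Definition emb (nu : nat) (i0 : 'I_nu.+2) (k : 'I_nu.+1) (j : 'I_nu) : 'I_nu.+2 :=
  lift i0 (lift k j).

Definition offset (nu : nat) (i0 : 'I_nu.+2) (k : 'I_nu.+1)
    (t y : 'I_nu.+2 -> int) (j : 'I_nu) : int :=
  y (emb i0 k j) - t (emb i0 k j).

(* The coordinates of a point y near t with y_i0 = 1, in terms of the offsets
   y_j - t_j for j different from i0 and i1 = lift i0 k, when y_i1 is given by
   the polynomial g. *)
Definition chart (nu : nat) (i0 : 'I_nu.+2) (k : 'I_nu.+1)
    (t : 'I_nu.+2 -> int) (g : {mpoly int[nu]}) (i : 'I_nu.+2) : {mpoly int[nu]} :=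
  if unlift i0 i is Some l
  then if unlift k l is Some j then 'X_j + (t i)%:MP else g
  else 1.

Lemma meval_chart (nu : nat) (i0 : 'I_nu.+2) (k : 'I_nu.+1)
    (t y : 'I_nu.+2 -> int) (g : {mpoly int[nu]}) (F : {mpoly int[nu.+2]}) :
  (F \mPo [tuple chart i0 k t g i | i < nu.+2]).@[offset i0 k t y]
    = F.@[upd (lift i0 k) (upd i0 y 1) g.@[offset i0 k t y]].
Proof.
rewrite comp_mpoly_meval; apply: meval_eq => i; rewrite tnth_mktuple.
rewrite /chart /upd; case: unliftP => [l ->|->]; last first.
  by rewrite (negPf (neq_lift _ _)) eqxx meval1.
rewrite (inj_eq lift_inj) eq_sym [_ == i0]eq_sym (negPf (neq_lift _ _)).
case: unliftP => [j ->|->]; last by rewrite eqxx.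
by rewrite (negPf (neq_lift _ _)) mevalD mevalXU mevalC /offset subrK.
Qed.

(** Newton iteration run on polynomials instead of numbers: one [g] serves all [y] in the residue
    class of [t], so that a form can be expanded in the offsets uniformly over that class. *)
Lemma hensel_chart (nu : nat) (F : {mpoly int[nu.+2]}) (p b : int)
    (t : 'I_nu.+2 -> int) (i0 : 'I_nu.+2) (k : 'I_nu.+1) :
  (p %| b * F^`M(lift i0 k).@[t] - 1)%Z ->
  forall N : nat, exists g : {mpoly int[nu]}, forall y : 'I_nu.+2 -> int,
    (forall i, (p %| y i - t i)%Z) -> (p ^+ N.+1 %| y i0 - 1)%Z ->
    (p ^+ N.+1 %| F.@[y])%Z ->
    (p ^+ N.+1 %| y (lift i0 k) - g.@[offset i0 k t y])%Z.
Proof.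
move=> pb; elim=> [|N [g gP]].
  by exists (t (lift i0 k))%:MP => y yt _ _; rewrite mevalC expr1.
(* A Newton step with the fixed inverse b of dF/dx_i1(t) mod p gains one
   power of p. *)
exists (g - b *: (F \mPo [tuple chart i0 k t g i | i < nu.+2])) => y yt y0 Fy.
have le_p : (p ^+ N.+1 %| p ^+ N.+2)%Z by apply: dvdz_exp2l.
have := gP y yt (dvdz_trans le_p y0) (dvdz_trans le_p Fy).
set w := offset _ _ _ _; set i1 := lift i0 k => /dvdzP[e eE].
(* The chart has the exact value 1 at [i0], whereas y_i0 is 1 only modulo p^(N+2); [y1] bridges the
   two. *)
rewrite mevalB mevalZ meval_chart -/w -/i1; set y1 := upd i0 y 1.
have y1y i : (p ^+ N.+2 %| y1 i - y i)%Z.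
  rewrite /y1 /upd; case: eqP => [->|_]; last by rewrite subrr dvdz0.
  by rewrite -opprB rpredN.
have Fy1 : (p ^+ N.+2 %| F.@[y1])%Z.
  rewrite -[F.@[y1]](subrK F.@[y]); apply: rpredD => //; exact: meval_cong.
have y1i1 : y1 i1 = y i1 by rewrite /y1 /upd eq_sym (negPf (neq_lift _ _)).
have upd1 a : y1 i1 = a -> F.@[upd i1 y1 a] = F.@[y1].
  by move=> <-; apply: meval_eq => i; rewrite /upd; case: eqP => [->|].
have dF : (p %| b * F^`M(i1).@[y1] - 1)%Z.
  have -> : b * F^`M(i1).@[y1] - 1
      = b * (F^`M(i1).@[y1] - F^`M(i1).@[t]) + (b * F^`M(i1).@[t] - 1) by ring.
  apply: rpredD => //; apply/dvdz_mull/meval_cong => i.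
  rewrite -(subrK (y i) (y1 i)) -addrA; apply: rpredD => //.
  by apply: (dvdz_trans _ (y1y i)); rewrite exprS dvdz_mulr.
rewrite -horner_slice.
have -> : g.@[w] = y i1 + (- (e * p ^+ N.+1)) by rewrite -eE; ring.
have [l ->] := horner_taylor2 (slice i1 y1 F) (y i1) (- (e * p ^+ N.+1)).
rewrite deriv_slice !horner_slice upd1 //.
have -> : F^`M(i1).@[upd i1 y1 (y i1)] = F^`M(i1).@[y1].
  by apply: meval_eq => i; rewrite /upd; case: eqP => [->|].
set G := F^`M(i1).@[y1] in dF *; set F1 := F.@[y1] in Fy1 *.
(* The new error has three parts: b F(y1), divisible by assumption; the old error times 1 - b G,
   which gains one p because b inverts G modulo p; and the quadratic Taylor term, divisible by
   p^(2N+2). *)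
have -> : y i1 - (y i1 + - (e * p ^+ N.+1)
      - b * (F1 + G * - (e * p ^+ N.+1) + (- (e * p ^+ N.+1)) ^+ 2 * l))
   = b * F1 + p ^+ N.+1 * - (b * G - 1) * e + p ^+ N.+2 * (b * p ^+ N * e ^+ 2 * l).
  by rewrite !exprS; ring.
apply: rpredD; last exact: dvdz_mulr.
apply: rpredD; first exact: dvdz_mull.
by rewrite -(mulrA) [p ^+ N.+2]exprSr; apply: dvdz_mul => //; rewrite dvdz_mulr ?rpredN.
Qed.

(** * Forms divisible by a prime power on a residue class *)

Lemma dvdz_meval (n m : nat) (q : {mpoly int[n]}) (p : int) (w : 'I_n -> int) :
  (forall j, (p %| w j)%Z) ->
  (forall a : 'X_{1..n < m}, (p ^+ (m - mdeg a) %| q@_a)%Z) ->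
  (p ^+ m %| q.@[w])%Z.
Proof.
move=> pw pq; rewrite mevalE; apply: rpred_sum => a _.
(* The monomial w^a supplies p^|a| by itself, so only p^(m - |a|) is asked of its coefficient, and
   nothing once |a| >= m. *)
have pwa : (p ^+ mdeg a %| \prod_i w i ^+ a i)%Z.
  rewrite mdegE -prodrXr; apply: (big_ind2 (fun x y => (x %| y)%Z)) => //.
    by move=> *; exact: dvdz_mul.
  by move=> i _; exact: dvdz_exp2r.
case: (ltnP (mdeg a) m) => [a_lt|a_ge].
  have := pq (BMultinom a_lt); rewrite /= => pqa.
  by rewrite -(subnK (ltnW a_lt)) exprD dvdz_mul.
apply/dvdz_mull/(dvdz_trans _ pwa); exact: dvdz_exp2l.
Qed.

Definition form_of (n : nat) (I : finType) (M : I -> 'X_{1..n}) (c : I -> int) :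
  {mpoly int[n]} := \sum_i c i *: 'X_[M i].

Lemma meval_form_of (n : nat) (I : finType) (M : I -> 'X_{1..n})
    (c : I -> int) (x : 'I_n -> int) :
  (form_of M c).@[x] = \sum_i c i * \prod_j x j ^+ M i j.
Proof.
by rewrite raddf_sum; apply: eq_bigr => i _; rewrite /= mevalZ mevalX.
Qed.

Lemma form_of_dhomog (n D : nat) (I : finType) (M : I -> 'X_{1..n})
    (c : I -> int) :
  (forall i, mdeg (M i) = D) -> form_of M c \is D.-homog.
Proof.
by move=> MD; apply: rpred_sum => i _; apply: rpredZ; rewrite dhomogX /= MD.
Qed.

(** Read in the chart of [hensel_chart], each monomial becomes a polynomial in the offsets;
    [siegel_lattice] makes the coefficients of the combined polynomial satisfy the hypothesis of
    [dvdz_meval]. The factor [u] expresses that [x] and [t] are the same projective point modulo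
    p. *)
Lemma local_siegel (nu d D m : nat) (F : {mpoly int[nu.+2]}) (I : finType)
    (M : I -> 'X_{1..nu.+2}) (K : I -> nat) (p : nat) (b : int)
    (t : 'I_nu.+2 -> int) (i0 : 'I_nu.+2) (k : 'I_nu.+1) :
  F \is d.-homog -> (forall i, mdeg (M i) = D) -> (0 < p)%N -> (0 < m)%N ->
  t i0 = 1 -> (p %| b * F^`M(lift i0 k).@[t] - 1)%Z ->
  (\prod_(a : 'X_{1..nu < m}) p ^ (m - mdeg a) < \prod_i (K i).+1)%N ->
  exists c : I -> int,
    [/\ exists i, c i != 0, forall i, (`|c i| <= K i)%N
      & forall x u, (forall i, (p %| u * x i - t i)%Z) -> F.@[x] = 0 ->
          ((p ^ m)%N %| (form_of M c).@[x])%Z].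
Proof.
move=> Fd MD p_gt0; case: m => // N _ t1 pb lt_pK.
have [g gP] := hensel_chart pb N.
pose h i := 'X_[M i] \mPo [tuple chart i0 k t g i | i < nu.+2].
have p_gt0' (a : 'X_{1..nu < N.+1}) : (0 < p ^ (N.+1 - mdeg a))%N.
  by rewrite expn_gt0 p_gt0.
have [c [cnz cK cP]] := siegel_lattice (fun a i => (h i)@_(val a)) p_gt0' lt_pK.
exists c; split=> // x u ut Fx.
have pX e : ((p ^ e)%N : int) = (p : int) ^+ e.
  by elim: e => // e IHe; rewrite expnS exprS PoszM IHe.
have cop : coprimez (p : int) (x i0).
  have := ut i0; rewrite t1 => /dvdzP[l lE].
  by apply/coprimezP; exists (- l, u) => /=; rewrite -[1](subKr (u * x i0)) lE; ring.
(* Rescaling x by the inverse v of x_i0 modulo p^m moves it into the chart. *)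
have /coprimezP[[l v] /= lv] : coprimez ((p : int) ^+ N.+1) (x i0).
  exact: coprimezXl.
pose y i := v * x i.
have y0 : ((p : int) ^+ N.+1 %| y i0 - 1)%Z.
  by apply/dvdzP; exists (- l); rewrite /y -lv; ring.
have pp : ((p : int) %| (p : int) ^+ N.+1)%Z by rewrite exprS dvdz_mulr.
(* Both u and v invert x_i0 modulo p, so rescaling by v instead of u stays in the residue class of
   [t]. *)
have uv : ((p : int) %| v - u)%Z.
  rewrite -(Gauss_dvdzl _ cop).
  have -> : (v - u) * x i0 = (y i0 - 1) - (u * x i0 - t i0) by rewrite t1 /y; ring.
  by apply: rpredB => //; exact: dvdz_trans y0.
have yt i : ((p : int) %| y i - t i)%Z.
  have -> : y i - t i = (v - u) * x i + (u * x i - t i) by rewrite /y; ring.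
  by apply: rpredD => //; exact: dvdz_mulr.
have Fy : F.@[y] = 0 by rewrite (meval_dhomog _ _ Fd) Fx mulr0.
have := gP y yt y0; rewrite Fy dvdz0 => /(_ isT).
set w := offset _ _ _ _; set i1 := lift i0 k => gw.
have H : ((p : int) ^+ N.+1 %| (\sum_i c i *: h i).@[w])%Z.
  apply: dvdz_meval => [j|a]; first exact: yt.
  rewrite raddf_sum /= -pX; have := cP a.
  congr (_ %| _)%Z; apply: eq_bigr => i _; by rewrite mcoeffZ mulrC.
pose z := upd i1 (upd i0 y 1) g.@[w].
have Hz : (\sum_i c i *: h i).@[w] = (form_of M c).@[z].
  rewrite !raddf_sum /=; apply: eq_bigr => i _.
  by rewrite !mevalZ /h meval_chart.
have zy i : ((p : int) ^+ N.+1 %| y i - z i)%Z.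
  rewrite /z /upd; case: eqP => [->|_] //.
  by case: eqP => [->|_]; rewrite // subrr dvdz0.
have : ((p : int) ^+ N.+1 %| (form_of M c).@[y])%Z.
  rewrite -[X in (_ %| X)%Z](subrK (form_of M c).@[z]).
  by apply: rpredD; [exact: meval_cong|rewrite -Hz].
(* By homogeneity the value at y is v^D times the value at x, and v^D is prime to p. *)
rewrite (meval_dhomog v x (form_of_dhomog c MD)) pX.
rewrite Gauss_dvdzr // coprimezXr //.
by apply/coprimezP; exists (l, x i0) => /=; rewrite -lv; ring.
Qed.

(** * Monomials of maximal weight *)

Definition weight (R : realType) (n : nat) (B : 'I_n -> R) (m : 'X_{1..n}) : R :=
  \prod_(i < n) B i ^+ m i.

Lemma weightD (R : realType) (n : nat) (B : 'I_n -> R) (m1 m2 : 'X_{1..n}) :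
  weight B (m1 + m2)%MM = weight B m1 * weight B m2.
Proof.
by rewrite /weight -big_split; apply: eq_bigr => i _; rewrite mnmDE exprD.
Qed.

Lemma weight_gt0 (R : realType) (n : nat) (B : 'I_n -> R) (m : 'X_{1..n}) :
  (forall i, 0 < B i) -> 0 < weight B m.
Proof. by move=> B_gt0; apply: prodr_gt0 => i _; exact: exprn_gt0. Qed.

Lemma seq_argmax (T : eqType) (d : Order.disp_t) (R : orderType d) (w : T -> R)
    (s : seq T) :
  s != [::] -> exists2 x, x \in s & forall y, y \in s -> (w y <= w x)%O.
Proof.
elim: s => // x [|z s] IHs _; first by exists x => [|y]; rewrite inE // => /eqP ->.
have [//|v vs vP] := IHs; have [wxv|wvx] := leP (w x) (w v).
  exists v => [|y]; first by rewrite inE vs orbT.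
  by rewrite inE => /predU1P[->|/vP].
exists x => [|y]; first exact: mem_head.
by rewrite inE => /predU1P[->|/vP/le_trans->] //; exact: ltW.
Qed.

Definition mpart (R : nzRingType) (n : nat) (P : pred 'X_{1..n})
    (p : {mpoly R[n]}) : {mpoly R[n]} :=
  \sum_(m <- msupp p | P m) p@_m *: 'X_[m].

Lemma mcoeff_mpart (R : nzRingType) (n : nat) (P : pred 'X_{1..n})
    (p : {mpoly R[n]}) (m : 'X_{1..n}) :
  (mpart P p)@_m = if P m then p@_m else 0.
Proof.
rewrite /mpart raddf_sum /=.
under eq_bigr do rewrite mcoeffZ mcoeffX.
have [mp|mNp] := boolP (m \in msupp p); last first.
  rewrite (memN_msupp_eq0 mNp) if_same big_seq_cond big1 // => k /andP[kp _].
  by case: eqP kp mNp => [->|_ _ _]; [move=> ->|rewrite mulr0].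
have [Pm|NPm] := boolP (P m); last first.
  apply: big1 => k Pk; case: eqP => [km|]; last by rewrite mulr0.
  by rewrite -km Pk in NPm.
rewrite big_mkcond (bigD1_seq m) //= Pm eqxx mulr1 big1 ?addr0 // => k /negPf ->.
by rewrite mulr0 if_same.
Qed.

Lemma top_part (R : realType) (n : nat) (B : 'I_n -> R) (p : {mpoly rat[n]}) :
  p != 0 -> exists (w : R),
    [/\ mpart (fun m => weight B m == w) p != 0
      & forall m, m \in msupp p -> weight B m <= w].
Proof.
rewrite -msupp_eq0 => /(seq_argmax (weight B))[m mp mP]; exists (weight B m); split=> //.
apply/eqP => /(congr1 (mcoeff m)); rewrite mcoeff_mpart eqxx mcoeff0 => /eqP.
by rewrite mcoeff_eq0 mp.
Qed.

Lemma toQ_neq0 (n : nat) (F : {mpoly int[n]}) : F != 0 -> toQ F != 0.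
Proof.
apply: contraNneq => F0; apply/eqP/mpolyP => m; move/(congr1 (mcoeff m)): F0.
by rewrite mcoeff_map_mpoly !mcoeff0 => /eqP; rewrite intr_eq0 => /eqP.
Qed.

Lemma msupp_toQ (n : nat) (F : {mpoly int[n]}) m :
  (m \in msupp (toQ F)) = (m \in msupp F).
Proof. by rewrite !mcoeff_msupp mcoeff_map_mpoly intr_eq0. Qed.

(* Ties between monomials of maximal weight are broken with the monomial order
   of the library: f is the leading monomial of the part of F of maximal weight. *)
Lemma boxT_monomial (R : realType) (n : nat) (B : 'I_n -> R) (F : {mpoly int[n]}) :
  (forall i, 0 < B i) -> F != 0 -> exists f : 'X_{1..n},
    [/\ f \in msupp F, boxT B F = weight B f
      & forall G, G != 0 -> (forall m, m \in msupp G -> ~~ (f <= m)%MM) ->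
          ~ dvdQ F G].
Proof.
move=> B_gt0 F0; have [w [wtop wmax]] := top_part B (toQ_neq0 F0).
set T := mpart _ _ in wtop; pose f := mlead T.
have := mlead_supp wtop; rewrite mcoeff_msupp mcoeff_mpart.
case: ifP => [/eqP wf fF|]; last by rewrite eqxx.
exists f; have {}fF : f \in msupp F by rewrite -msupp_toQ mcoeff_msupp.
split=> //.
  apply/eqP; rewrite eq_le; apply/andP; split.
    rewrite /boxT big_seq; apply: bigmax_le; first exact/ltW/weight_gt0.
    by rewrite [weight B f]wf => m; rewrite -msupp_toQ => /wmax.
  exact: le_bigmax_seq.
move=> G G0 fG [r rE].
have r0 : r != 0 by apply: contraNneq (toQ_neq0 G0) => r0; rewrite rE r0 mul0r.
have [v [vtop vmax]] := top_part B r0; set S := mpart _ _ in vtop.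
pose h := mlead S.
have := mlead_supp vtop; rewrite mcoeff_msupp mcoeff_mpart.
case: ifP => [/eqP vh _|]; last by rewrite eqxx.
have vw : weight B (h + f)%MM = v * w by rewrite weightD /f /h wf vh.
(* If one factor has weights at most a and the other has weights below b, the product has no
   monomial of weight ab. This removes the cross terms below. *)
have cross (p q : {mpoly rat[n]}) a b : 0 < a ->
    (forall m, m \in msupp p -> weight B m <= a) ->
    (forall m, m \in msupp q -> weight B m < b) -> weight B (h + f)%MM = a * b ->
    (p * q)@_(h + f)%MM = 0.
  move=> a_gt0 pa qb hab; apply: memN_msupp_eq0; apply/negP => /msuppM_le.
  case/allpairsP => -[m1 m2] [/= /pa m1a /qb m2b hE].
  have : weight B (h + f)%MM < a * b.
    rewrite hE weightD; apply: le_lt_trans (_ : _ <= a * weight B m2) _.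
      by rewrite ler_wpM2r // ltW // weight_gt0.
    by rewrite ltr_pM2l.
  by rewrite hab ltxx.
have lo (p : {mpoly rat[n]}) (a : R) :
    (forall m, m \in msupp p -> weight B m <= a) ->
    forall m, m \in msupp (p - mpart (fun k => weight B k == a) p) -> weight B m < a.
  move=> pa m; rewrite mcoeff_msupp mcoeffB mcoeff_mpart /=.
  case: (weight B m =P a) => [_|/eqP ne]; first by rewrite subrr eqxx.
  by rewrite subr0 lt_neqAle ne -mcoeff_msupp => /pa.
have top (p : {mpoly rat[n]}) (a : R) :
    forall m, m \in msupp (mpart (fun k => weight B k == a) p) -> weight B m <= a.
  move=> m; rewrite mcoeff_msupp mcoeff_mpart /=.
  by case: (weight B m =P a) => [->|]; rewrite ?eqxx.
have v_gt0 : 0 < v by rewrite -vh weight_gt0.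
have w_gt0 : 0 < w by rewrite -wf weight_gt0.
(* Only the product of the two top parts reaches the weight v w, and its leading coefficient is a
   product of two nonzero ones. *)
have : (toQ G)@_(h + f)%MM != 0.
  have -> : toQ G = S * T + (S * (toQ F - T) + toQ F * (r - S)) by rewrite rE; ring.
  have c1 := cross _ _ _ _ v_gt0 (top _ _) (lo _ _ wmax) vw.
  have c2 := cross _ _ _ _ w_gt0 wmax (lo _ _ vmax) (etrans vw (mulrC _ _)).
  rewrite mcoeffD [X in _ + X]mcoeffD c1 c2.
  by rewrite !addr0 mleadcM mulf_neq0 // mleadc_eq0.
by rewrite -mcoeff_msupp msupp_toQ => /fG; rewrite lem_addl.
Qed.

(** * Counting monomials *)

(** By degree: a nonzero multiple of [F] has degree at least d + 1, and the derivative only has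
    degree d. *)
Lemma ndvdQ_mderiv (n d : nat) (F : {mpoly int[n]}) (i : 'I_n) :
  F \is d.+1.-homog -> F^`M(i) != 0 -> ~ dvdQ F F^`M(i).
Proof.
move=> Fd dF0 [r rE].
have msz (G : {mpoly int[n]}) e : G != 0 -> G \is e.-homog -> msize (toQ G) = e.+1.
  move=> G0 /dhomogP Ge; rewrite -mlead_deg ?toQ_neq0 //; congr _.+1.
  by apply: Ge; rewrite -msupp_toQ mlead_supp // toQ_neq0.
have F0 : F != 0 by apply: contraNneq dF0 => ->; rewrite mderiv0.
have r0 : r != 0.
  by apply: contraNneq (toQ_neq0 dF0) => r0; rewrite rE r0 mul0r.
have := congr1 (fun p => msize p) rE; rewrite /=.
rewrite msizeM ?toQ_neq0 // (msz _ _ dF0 (mderiv_dhomog _ Fd)) (msz _ _ F0 Fd).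
have : (0 < msize r)%N by rewrite lt0n msize_poly_eq0.
by case: (msize r) => // s _; rewrite addSn /=; lia.
Qed.

Definition mons (n d : nat) : seq 'X_{1..n} :=
  [seq s2m t | t : d.-tuple 'I_n <- enum (basis n d)].

Lemma mem_mons n d m : (m \in mons n d) = (mdeg m == d).
Proof. by rewrite basis_cover. Qed.

Lemma mons_uniq n d : uniq (mons n d). Proof. exact: uniq_basis. Qed.

Lemma size_mons n d : size (mons n.+1 d) = 'C(d + n, n).
Proof. by rewrite size_basis -bin_sub ?leq_addr // addKn. Qed.

Lemma mons_shift n d D (f : 'X_{1..n}) : mdeg f = d ->
  perm_eq [seq m <- mons n (d + D) | (f <= m)%MM] [seq (f + m)%MM | m <- mons n D].
Proof.
move=> fd; apply: uniq_perm.
- by rewrite filter_uniq // mons_uniq.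
- by rewrite map_inj_uniq ?mons_uniq //; exact: addmI.
move=> m; rewrite mem_filter mem_mons; apply/andP/mapP => [[fm /eqP md]|[k]].
  exists (m - f)%MM; last by rewrite addmC submK.
  by rewrite mem_mons -(eqn_add2l d) -{1}fd -mdegD addmC submK // md.
by rewrite mem_mons => /eqP kD ->; rewrite lem_addr mdegD fd kD.
Qed.

(** Induction on D: monomials without x_i contribute nothing, and the others are x_i times the
    monomials of degree one less, which gives Pascal's rule. *)
Lemma sum_mons n D (i : 'I_n.+1) :
  (\sum_(m <- mons n.+1 D) m i = 'C(D + n, n.+1))%N.
Proof.
elim: D => [|D IHD].
  rewrite bin_small // big_seq big1 // => m; rewrite mem_mons mdeg_eq0 => /eqP ->.
  by rewrite mnm0E.
rewrite (bigID (fun m : 'X_{1..n.+1} => (U_(i) <= m)%MM)) /= [X in (_ + X)%N]big1 ?addn0.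
  rewrite -big_filter -[D.+1]add1n (perm_big _ (mons_shift D (mdeg1 i))) /= big_map.
  under eq_bigr do rewrite mnmDE mnm1E eqxx.
  by rewrite big_split /= IHD sum1_size size_mons add1n addSn binS addnC.
by move=> m; rewrite lep1mP negbK => /eqP.
Qed.

Lemma prod_weight_mons (R : realType) n D (B : 'I_n.+1 -> R) :
  \prod_(m <- mons n.+1 D) weight B m = boxV B ^+ 'C(D + n, n.+1).
Proof.
rewrite exchange_big /= /boxV -prodrXl; apply: eq_bigr => i _.
by rewrite prodrXr sum_mons.
Qed.

(** The monomials allowed in the auxiliary form. With f taken from [boxT_monomial], no nonzero
    combination of them is a multiple of [F]. *)
Definition mons_free n d (f : 'X_{1..n}) : seq 'X_{1..n} :=
  [seq m <- mons n d | ~~ (f <= m)%MM].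

Lemma size_mons_free n d D (f : 'X_{1..n.+1}) : mdeg f = d ->
  (size (mons_free (d + D) f) + 'C(D + n, n) = 'C(d + D + n, n))%N.
Proof.
move=> fd; rewrite -!size_mons -(count_predC (fun m => (f <= m)%MM) (mons _ (d + D))).
by rewrite addnC -!size_filter (perm_size (mons_shift D fd)) (size_map (mnm_add f)).
Qed.

(** The monomials of degree d + D split into the free ones and f times those of degree D. The
    identity is multiplied out to avoid division. *)
Lemma prod_weight_mons_free (R : realType) n d D (B : 'I_n.+1 -> R)
    (f : 'X_{1..n.+1}) : mdeg f = d ->
  (\prod_(m <- mons_free (d + D) f) weight B m) * weight B f ^+ 'C(D + n, n)
    * boxV B ^+ 'C(D + n, n.+1) = boxV B ^+ 'C(d + D + n, n.+1).
Proof.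
move=> fd; rewrite -(prod_weight_mons D B) -(prod_weight_mons (d + D) B).
have shift : \prod_(m <- mons n.+1 (d + D) | (f <= m)%MM) weight B m
    = weight B f ^+ 'C(D + n, n) * \prod_(m <- mons n.+1 D) weight B m.
  rewrite -big_filter (perm_big _ (mons_shift D fd)) /= big_map.
  under eq_bigr do rewrite weightD.
  by rewrite big_split /= big_const_seq count_predT iter_mulr_1 size_mons.
rewrite [RHS](bigID (fun m => (f <= m)%MM)) /= shift [RHS]mulrC mulrA.
by rewrite /mons_free big_filter.
Qed.

Lemma sum_bmultinom n m (g : 'X_{1..n} -> nat) :
  (\sum_(a : 'X_{1..n < m}) g a = \sum_(k < m) \sum_(a <- mons n k) g a)%N.
Proof.
transitivity (\sum_(a : 'X_{1..n < m}) \sum_(k < m | mdeg a == k) g a)%N.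
  apply: eq_bigr => a _; rewrite (big_pred1 (Ordinal (bmdeg a))) //.
rewrite (exchange_big_dep predT) //=; apply: eq_bigr => k _.
rewrite -big_filter -(big_map val predT g); apply: perm_big; apply: uniq_perm.
- by rewrite map_inj_uniq ?filter_uniq ?index_enum_uniq //; exact: val_inj.
- exact: mons_uniq.
move=> a; rewrite mem_mons; apply/mapP/idP => [[b]|ak].
  by rewrite mem_filter => /andP[/eqP bk _] ->; rewrite bk.
have am : (mdeg a < m)%N by rewrite (eqP ak) ltn_ord.
by exists (BMultinom am) => //; rewrite mem_filter ak mem_index_enum.
Qed.

(** The exponent of p in the bound for the number of residue vectors in [local_siegel]. Raising m by
    one adds 1 for each monomial of degree at most m, and these are counted by the hockey-stick
    identity. *)
Lemma sum_codeg n m :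
  (\sum_(a : 'X_{1..n.+1 < m}) (m - mdeg a) = 'C(m + n.+1, n.+2))%N.
Proof.
rewrite (sum_bmultinom m (fun a => (m - mdeg a)%N)).
transitivity (\sum_(k < m) 'C(k + n, n) * (m - k))%N.
  apply: eq_bigr => k _; rewrite -size_mons -sum1_size big_distrl /=.
  rewrite big_seq [RHS]big_seq; apply: eq_bigr => a.
  by rewrite mem_mons mul1n => /eqP ->.
have hockey l : (\sum_(k < l) 'C(k + n, n) = 'C(l + n, n.+1))%N.
  elim: l => [|l IHl]; first by rewrite big_ord0 bin_small.
  by rewrite big_ord_recr /= IHl -binS.
elim: m => [|m IHm]; first by rewrite big_ord0 bin_small.
transitivity (\sum_(k < m.+1) ('C(k + n, n) * (m - k) + 'C(k + n, n)))%N.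
  apply: eq_bigr => k _; rewrite subSn ?mulnS 1?addnC //; exact: (ltn_ord k).
rewrite big_split /= hockey big_ord_recr /= subnn muln0 addn0 IHm.
by rewrite !addSn [RHS]binS addnS.
Qed.

(** * Choice of the degree *)

Lemma leq_ffact_exp n k : (n ^_ k <= n ^ k)%N.
Proof.
elim: k n => // k IHk n; rewrite ffactnS expnS leq_mul2l.
case: n => // n; rewrite (leq_trans (IHk _)) ?orbT //=.
by case: k {IHk} => // k; rewrite leq_exp2r.
Qed.

Lemma leq_exp_ffact n k : (n ^ k <= (n + k) ^_ k)%N.
Proof.
elim: k => // k IHk; rewrite addnS ffactSS expnS leq_mul //.
by rewrite -addnS leq_addr.
Qed.

(** Iterated Pascal rule. It writes the differences of binomials in [parameters] as sums of d terms,
    which are then estimated one by one. *)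
Lemma bin_increment d x k :
  ('C(d + x, k.+1) = 'C(x, k.+1) + \sum_(j < d) 'C(j + x, k))%N.
Proof.
elim: d => [|d IHd]; first by rewrite big_ord0 addn0.
by rewrite addSn binS IHd big_ord_recr addnA.
Qed.

(** A bounded shift of the base costs only a term of lower order, with K independent of x. *)
Lemma expr_shift_le (R : realType) (c : R) (k : nat) : 0 <= c ->
  exists2 K : R, 0 <= K &
    forall x, 1 <= x -> (x + c) ^+ k.+1 <= x ^+ k.+1 + K * x ^+ k.
Proof.
move=> c0; elim: k => [|k [K K0 KP]].
  by exists c => // x _; rewrite !expr1 expr0 mulr1.
exists (K + c + c * K) => [|x x1]; first by rewrite !addr_ge0 ?mulr_ge0.
have x0 : 0 <= x := le_trans ler01 x1.
have := ler_wpM2l (addr_ge0 x0 c0) (KP x x1).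
rewrite -exprS => /le_trans; apply.
have : x ^+ k <= x ^+ k.+1 by rewrite exprS ler_peMl // exprn_ge0.
move=> /(ler_wpM2l (mulr_ge0 c0 K0)).
rewrite [x ^+ k.+2]exprS [x ^+ k.+1]exprS => H.
nra.
Qed.

(* Here nu = n - 2 and A is the exponent of p that remains in p^(m s) once the
   index p^C(m+nu, nu+1) of the lattice is divided out. For m close to
   d^(1/nu) D it is asymptotic to nu d^((nu+1)/nu) D^(nu+1) / (nu+1)!, while
   the product of the monomials at B is (V^d / T)^b V^(a - d b) with b
   asymptotic to D^(nu+1) / (nu+1)! and a - d b of order D^nu. *)
Lemma parameters (R : realType) (nu d : nat) (eta : R) :
  (0 < nu)%N -> (0 < d)%N -> 0 < eta ->
  exists D m A a : nat,
    let s := ('C(d + D + nu.+1, nu.+1) - 'C(D + nu.+1, nu.+1))%N in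
    let b := 'C(D + nu.+1, nu.+1) in
    [/\ (0 < m)%N, (0 < A)%N, (m * s = A + 'C(m + nu, nu.+1))%N,
       ('C(d + D + nu.+1, nu.+2) = a + 'C(D + nu.+1, nu.+2))%N
     & b%:R <= (d%:R `^ (- (nu.+1%:R / nu%:R)) / nu%:R + eta) * A%:R :> R
     /\ a%:R <= d%:R * b%:R + eta * A%:R :> R].
Proof.
move=> nu_gt0 d_gt0 eta_gt0.
have nuR : 0 < nu%:R :> R by rewrite ltr0n.
have dR : 1 <= d%:R :> R by rewrite ler1n.
have dR0 : 0 < d%:R :> R by rewrite ltr0n.
(* The ratio m / D to aim for; below, m is the integer part of lam D. *)
pose lam : R := d%:R `^ nu%:R^-1.
have lam1 : 1 <= lam.
  by rewrite -[leLHS](powRr0 d%:R) ler_powR // invr_ge0 ltW.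
have lam0 : 0 < lam := lt_le_trans ltr01 lam1.
have lamX : lam ^+ nu = d%:R.
  by rewrite -powR_mulrn ?ltW // -powRrM mulVf ?gt_eqF // powRr1 // ltW.
pose kap : R := d%:R `^ (- (nu.+1%:R / nu%:R)) / nu%:R.
rewrite -/kap.
have kapE : kap = (nu%:R * lam * d%:R)^-1.
  rewrite /kap -natr1 mulrDl divff ?gt_eqF // powRN powRD; last first.
    by rewrite (gt_eqF dR0) implybT.
  rewrite powRr1 ?ltW // mul1r -/lam !invfM; ring.
have kap0 : 0 < kap by rewrite kapE invr_gt0 !mulr_gt0.
(* With f = (nu+1)!, the number f A is asymptotic to rho X^(nu+1): the term f m s gives (nu+1) lam
   d, from which the lattice index takes lam^(nu+1) = lam d. Moreover rho is the inverse of kap. *)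
pose rho := nu%:R * lam * d%:R; have rho0 : 0 < rho by rewrite !mulr_gt0.
have [K1 K10 K1P] := @expr_shift_le R nu%:R nu (ltW nuR).
have [K2 K20 K2P] := @expr_shift_le R nu.+1%:R nu (ler0n _ _).
have [K3 K30 K3P] := @expr_shift_le R (d + nu.+1)%:R nu (ler0n _ _).
pose K' := K1 * d%:R + nu.+1%:R * d%:R.
have K'0 : 0 <= K' by rewrite addr_ge0 // mulr_ge0 // ltW.
(* Chosen so that for D > Z the gain eta rho X exceeds the lower-order errors of all the estimates
   together. *)
pose Z := (K2 + d%:R * K3 + (kap + eta) * K' + 1) / (eta * rho).
pose D := (Num.truncn Z).+1; pose X : R := D%:R.
have ZX : Z < X by apply: truncnS_gt.
have X1 : 1 <= X by rewrite ler1n.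
have X0 : 0 < X := lt_le_trans ltr01 X1.
have lamX1 : 1 <= lam * X by rewrite mulr_ege1.
have etaX : K2 + d%:R * K3 + (kap + eta) * K' + 1 < eta * rho * X.
  by move: ZX; rewrite /Z ltr_pdivrMr ?mulr_gt0 // [X * _]mulrC.
pose m := Num.truncn (lam * X).
have m_gt0 : (0 < m)%N by rewrite truncn_gt0.
have /andP[mle mgt] : m%:R <= lam * X < m.+1%:R.
  by apply: truncn_itv; apply: ltW; exact: lt_le_trans lamX1.
pose s := ('C(d + D + nu.+1, nu.+1) - 'C(D + nu.+1, nu.+1))%N.
pose b := 'C(D + nu.+1, nu.+1).
pose a := ('C(d + D + nu.+1, nu.+2) - 'C(D + nu.+1, nu.+2))%N.
pose c := 'C(m + nu, nu.+1).
pose f : R := (nu.+1)`!%:R; have f0 : 0 < f by rewrite ltr0n fact_gt0.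
pose Y := X ^+ nu; have Y0 : 0 < Y by rewrite exprn_gt0.
have cY : f * c%:R <= lam * d%:R * X * Y + K1 * d%:R * Y.
  rewrite -natrM mulnC bin_ffact.
  apply: (@le_trans _ _ ((m + nu) ^ nu.+1)%:R); first by rewrite ler_nat leq_ffact_exp.
  apply: (@le_trans _ _ ((lam * X + nu%:R) ^+ nu.+1)).
    rewrite natrX; apply: lerXn2r; rewrite ?nnegrE ?ler0n //.
      by rewrite addr_ge0 ?mulr_ge0 ?ler0n ?(ltW lam0) ?(ltW X0).
    by rewrite natrD lerD2r.
  apply: (le_trans (K1P _ lamX1)).
  by rewrite exprS !exprMn lamX -/Y; lra.
have sE : s = (\sum_(j < d) 'C(j + (D + nu.+1), nu))%N.
  by rewrite /s -addnA bin_increment addKn.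
have sY : d%:R * nu.+1%:R * Y <= f * s%:R.
  have -> : f = nu.+1%:R * nu`!%:R by rewrite /f factS natrM.
  rewrite mulrAC -[leRHS]mulrA [leLHS]mulrC ler_wpM2l // /Y /X.
  rewrite -natrX -!natrM ler_nat sE big_distrr /=.
  have -> : (d * D ^ nu = \sum_(j < d) D ^ nu)%N by rewrite sum_nat_const card_ord.
  apply: leq_sum => j _; rewrite mulnC bin_ffact.
  apply: (leq_trans (leq_exp_ffact _ _)).
  rewrite -(bin_ffact (D + nu)) -(bin_ffact (j + _)) leq_mul2r leq_bin2l ?orbT //.
  by rewrite (leq_trans _ (leq_addl _ _)) // leq_add2l.
have bY : X * Y <= f * b%:R.
  rewrite /X /Y -exprS -natrX -natrM ler_nat mulnC bin_ffact; exact: leq_exp_ffact.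
have bY' : f * b%:R <= X * Y + K2 * Y.
  rewrite -natrM mulnC bin_ffact.
  apply: (@le_trans _ _ ((D + nu.+1) ^ nu.+1)%:R); first by rewrite ler_nat leq_ffact_exp.
  by rewrite natrX natrD -exprS; exact: K2P.
have aE : a = (\sum_(j < d) 'C(j + (D + nu.+1), nu.+1))%N.
  by rewrite /a -addnA bin_increment addKn.
have aY : f * a%:R <= d%:R * (X * Y + K3 * Y).
  apply: (@le_trans _ _ (d * (D + (d + nu.+1)) ^ nu.+1)%:R).
    rewrite -natrM ler_nat aE big_distrr /=.
    have -> k : (d * k = \sum_(j < d) k)%N by rewrite sum_nat_const card_ord.
    apply: leq_sum => j _; rewrite mulnC bin_ffact.
    apply: (leq_trans (leq_ffact_exp _ _)); rewrite leq_exp2r //.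
    by rewrite addnCA leq_add2l leq_add2r ltnW.
  rewrite natrM ler_wpM2l // natrX natrD -exprS; exact: K3P.
pose A : R := m%:R * s%:R - c%:R.
(* In K', the term with K1 comes from the upper bound for c, and (nu+1) d from rounding lam X down
   to m. *)
have AY : (rho * X - K') * Y <= f * A.
  have m1 : lam * X - 1 <= m%:R by rewrite lerBlDr natr1 ltW.
  have dY0 : 0 <= d%:R * nu.+1%:R * Y by rewrite !mulr_ge0 ?ler0n // ltW.
  have := ler_wpM2r dY0 m1.
  have := ler_wpM2l (ler0n R m) sY.
  move: cY; rewrite /A /rho /K' -[nu.+1%:R]natr1 => h1 h2 h3.
  rewrite mulrBr; lra.
have Kp : K' < rho * X.
  have : 0 <= kap * K' by rewrite mulr_ge0 // ltW.
  have : 0 <= d%:R * K3 by rewrite mulr_ge0 // ltW.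
  rewrite -(ltr_pM2l eta_gt0); lra.
have A0 : 0 < A.
  have : 0 < f * A by apply: lt_le_trans AY; rewrite mulr_gt0 // subr_gt0.
  by rewrite pmulr_rgt0.
have lt_c : (c < m * s)%N by rewrite -(ltr_nat R) natrM -subr_gt0.
exists D, m, (m * s - c)%N, a; split => //; rewrite -/s -/b -/c -/a.
- by rewrite subn_gt0.
- by rewrite subnK // ltnW.
- by rewrite /a subnK // leq_bin2l // -addnA leq_addl.
rewrite natrB ?(ltnW lt_c) // natrM -/A; split.
- rewrite -(ler_pM2l f0); apply: (le_trans bY').
  rewrite mulrCA; apply: (@le_trans _ _ ((kap + eta) * ((rho * X - K') * Y))).
    rewrite mulrA -mulrDl ler_wpM2r ?ltW //.
    have kr : kap * rho = 1 by rewrite kapE mulVf // gt_eqF.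
    rewrite mulrBr mulrA mulrDl kr.
    have : 0 <= d%:R * K3 by rewrite mulr_ge0 // ltW.
    lra.
  by rewrite ler_wpM2l // addr_ge0 // ltW.
- rewrite -(ler_pM2l f0); apply: (le_trans aY).
  rewrite mulrDr [f * (_ + _)]mulrDr [f * (d%:R * _)]mulrCA [f * (eta * _)]mulrCA.
  apply: lerD; first by rewrite ler_wpM2l // ltW.
  apply: (@le_trans _ _ (eta * ((rho * X - K') * Y))); last by rewrite ler_wpM2l // ltW.
  rewrite !mulrA ler_wpM2r ?ltW // mulrBr mulrA.
  have : 0 <= kap * K' by rewrite mulr_ge0 // ltW.
  lra.
Qed.

(** * Prime numbers *)

Lemma leq_exp2_bin N : (2 ^ N <= 'C(N.*2, N))%N.
Proof.
rewrite -(leq_pmul2r (fact_gt0 N)) bin_ffact -ffactnn !ffact_prod.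
have -> : (2 ^ N = \prod_(i < N) 2)%N by rewrite prod_nat_const card_ord.
rewrite -big_split /=; apply: leq_prod => i _; lia.
Qed.

(** By Legendre's formula the exponent is a sum of differences floor(2N/p^k) - 2 floor(N/p^k), each
    at most 1, over the k with p^k <= 2N. *)
Lemma logn_bin_double p N : prime p -> (0 < N)%N ->
  (p ^ logn p 'C(N.*2, N) <= N.*2)%N.
Proof.
move=> pr_p N_gt0; have p1 := prime_gt1 pr_p.
have N2_gt0 : (0 < N.*2)%N by rewrite double_gt0.
apply: leq_trans (trunc_logP p1 N2_gt0).
rewrite leq_exp2l //; set L := trunc_log p N.*2.
have C_gt0 : (0 < 'C(N.*2, N))%N by rewrite bin_gt0 -addnn leq_addr.
have := bin_fact (leq_addr N N); rewrite addnn => /(congr1 (logn p)).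
rewrite -addnn addnK addnn !lognM ?muln_gt0 ?fact_gt0 // !logn_fact //.
(* The sums for N! and (2N)! have different lengths; terms with p^k > n vanish, so both can be cut
   at [L]. *)
have ext n a b : (0 < a <= b)%N -> (n < p ^ a)%N ->
    (\sum_(1 <= k < a) n %/ p ^ k = \sum_(1 <= k < b) n %/ p ^ k)%N.
  move=> /andP[a0 ab] na; rewrite [RHS](big_cat_nat (n := a)) //=.
  rewrite [X in (_ + X)%N]big_nat_cond [X in (_ + X)%N]big1 ?addn0 //.
  move=> k /andP[/andP[ak _] _]; apply: divn_small.
  by apply: (leq_trans na); rewrite leq_exp2l.
have extL n : (n <= N.*2)%N ->
    (\sum_(1 <= k < n.+1) n %/ p ^ k = \sum_(1 <= k < L.+1) n %/ p ^ k)%N.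
  move=> nN; rewrite (ext n n.+1 (n.+1 + L)%N) ?leq_addr //; last first.
    by apply: leq_trans (ltn_expl _ p1).
  apply/esym/ext; first by rewrite /= addSn ltnS leq_addl.
  exact: leq_ltn_trans nN (trunc_log_ltn _ p1).
rewrite (extL N) -?addnn ?leq_addr // addnn (extL N.*2) // => eqS.
have : (\sum_(1 <= k < L.+1) N.*2 %/ p ^ k
    <= \sum_(1 <= k < L.+1) (N %/ p ^ k + N %/ p ^ k + 1))%N.
  apply: leq_sum => k _; have pk : (0 < p ^ k)%N by rewrite expn_gt0 ltnW.
  rewrite -ltnS ltn_divLR //.
  have := ltn_ceil N pk; nia.
rewrite !big_split /= sum_nat_const_nat subn1 muln1 /=; lia.
Qed.

(** Chebyshev's argument: the central binomial coefficient is at least 2^N, and each prime power in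
    its factorisation is at most 2N. *)
Lemma exp2_le_primes N : (0 < N)%N ->
  (2 ^ N <= N.*2 ^ size [seq p <- iota 0 N.*2.+1 | prime p])%N.
Proof.
move=> N_gt0; apply: leq_trans (leq_exp2_bin N) _.
have C_gt0 : (0 < 'C(N.*2, N))%N by rewrite bin_gt0 -addnn leq_addr.
rewrite [X in (X <= _)%N](prod_prime_decomp C_gt0) prime_decompE big_map /=.
set ps := primes _.
apply: (@leq_trans (\prod_(p <- ps) N.*2)); last first.
  rewrite big_const_seq count_predT iter_muln_1 leq_pexp2l ?double_gt0 //.
  apply: uniq_leq_size (primes_uniq _) _ => p.
  rewrite mem_primes => /and3P[pr_p _ pC].
  rewrite mem_filter pr_p mem_iota prime_gt0 // add1n ltnS /=.
  apply: leq_trans (logn_bin_double pr_p N_gt0).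
  by rewrite -{1}[p]expn1 leq_exp2l ?prime_gt1 // logn_gt0 mem_primes pr_p C_gt0.
rewrite big_seq [leqRHS]big_seq; apply: leq_prod => p.
by rewrite mem_primes => /and3P[pr_p _ _]; exact: logn_bin_double.
Qed.

Lemma many_primes (R : realType) (delta : R) : 0 < delta ->
  exists2 C : R, 0 < C & forall k : nat, exists ps : seq nat,
    [/\ uniq ps, all prime ps, (k <= size ps)%N
      & forall p, p \in ps -> p%:R <= C * k.+1%:R `^ (1 + delta)].
Proof.
move=> delta_gt0; have d1 : 0 < 1 + delta by rewrite addr_gt0.
pose e := delta / (1 + delta); have e0 : 0 < e by rewrite divr_gt0.
have eE : 1 - e = (1 + delta)^-1 by rewrite /e; field; rewrite gt_eqF.
have ln2 : 0 < ln 2%:R :> R by rewrite ln_gt0 // ltr1n.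
(* The estimate ln y <= y^e / e replaces the logarithm in Chebyshev's bound, with 1 - e = 1 / (1 +
   delta); c is then such that y^(1-e) > c k forces at least k primes up to y. *)
pose c := 2 / (e * ln 2%:R); have c0 : 0 < c by rewrite divr_gt0 // mulr_gt0.
exists (2 * (c `^ (1 + delta) + 1)) => [|k].
  by rewrite mulr_gt0 // addr_gt0 // powR_gt0.
pose Z := (c * k%:R) `^ (1 + delta).
have Z0 : 0 <= Z by exact: powR_ge0.
pose N := (Num.truncn Z).+1; pose y : R := N.*2%:R.
have ZN : Z < N%:R by exact: truncnS_gt.
have Zy : Z < y by apply: (lt_le_trans ZN); rewrite ler_nat -addnn leq_addr.
have y0 : 0 < y by rewrite ltr0n double_gt0.
exists [seq p <- iota 0 N.*2.+1 | prime p]; split.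
- by rewrite filter_uniq // iota_uniq.
- exact: filter_all.
- rewrite leqNgt; apply/negP => lt_k.
  have /(leq_trans (exp2_le_primes (ltn0Sn _)))/= :
      (N.*2 ^ size [seq p <- iota 0 N.*2.+1 | prime p] <= N.*2 ^ k)%N.
    by rewrite leq_pexp2l ?double_gt0 // ltnW.
  rewrite -(ler_nat R) !natrX -ler_ln ?posrE ?exprn_gt0 //.
  rewrite !lnXn // -/y; apply/negP; rewrite -ltNge.
  have : ln (y `^ e) < y `^ e by rewrite ln_sublinear // powR_gt0.
  rewrite ln_powR => lny.
  have yN : y = N%:R * 2 by rewrite /y -muln2 natrM.
  have cky : c * k%:R < y `^ (1 - e).
    rewrite eE; have -> : c * k%:R = Z `^ (1 + delta)^-1.
      by rewrite /Z -powRrM mulfV ?gt_eqF // powRr1 // mulr_ge0 // ltW.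
    by apply: gt0_ltr_powR; rewrite ?invr_gt0 ?nnegrE // ltW.
  have yE : y = y `^ e * y `^ (1 - e).
    rewrite -powRD; first by rewrite addrC subrK powRr1 // ltW.
    by rewrite (gt_eqF y0) implybT.
  rewrite -[ln y *+ k]mulr_natl -[ln 2%:R *+ N]mulr_natl.
  have k_e : k%:R * ln y <= k%:R / e * y `^ e.
    rewrite -mulrA ler_wpM2l // mulrC ler_pdivlMr // mulrC; exact: ltW.
  apply: (le_lt_trans k_e).
  have ye0 : 0 < y `^ e by exact: powR_gt0.
  have -> : k%:R / e * y `^ e = (c * k%:R) * y `^ e * (ln 2%:R / 2).
    by rewrite /c; field; rewrite !gt_eqF.
  have -> : N%:R * ln 2%:R = (y `^ (1 - e) * y `^ e) * (ln 2%:R / 2).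
    by rewrite [y `^ (1 - e) * _]mulrC -yE yN; field.
  by rewrite ltr_pM2r ?divr_gt0 // ltr_pM2r.
move=> p; rewrite mem_filter mem_iota add0n ltnS => /andP[_ pN].
apply: (@le_trans _ _ y); first by rewrite ler_nat.
have k1 : 1 <= k.+1%:R `^ (1 + delta) :> R.
  by rewrite -[leLHS](powRr0 k.+1%:R) ler_powR ?ler1n // ltW.
have Zk : Z <= c `^ (1 + delta) * k.+1%:R `^ (1 + delta).
  rewrite -powRM ?(ltW c0) //; apply: ge0_ler_powR;
    rewrite ?nnegrE ?(mulr_ge0 (ltW c0)) ?ler0n ?(ltW d1) //.
  by rewrite ler_pM2l // ler_nat.
have NZ : N%:R <= Z + 1 by rewrite -natr1 lerD2r truncn_le.
have -> : y = 2 * N%:R by rewrite /y -mul2n natrM.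
rewrite -mulrA ler_wpM2l // mulrDl mul1r.
by apply: (le_trans NZ); exact: lerD.
Qed.

(** At most floor(P) + 1 members of a list of distinct naturals are <= P, so that many extra primes
    are requested and the small ones dropped. *)
Lemma primes_above (R : realType) (delta : R) : 0 < delta ->
  exists2 C : R, 0 < C & forall (P : R) (r : nat), 0 <= P -> exists ps : seq nat,
    [/\ uniq ps, size ps = r & forall p, p \in ps ->
      [/\ prime p, P < p%:R & p%:R <= C * (r%:R + P + 2) `^ (1 + delta)]].
Proof.
move=> delta_gt0; have [C C0 CP] := many_primes delta_gt0.
exists C => // P r P0; have [ps [ups prps szps ps_le]] := CP (r + (Num.truncn P).+1)%N.
pose qs := [seq p <- ps | P < p%:R].
have szqs : (r <= size qs)%N.
  pose above (p : nat) := P < p%:R.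
  have : (count (predC above) ps <= (Num.truncn P).+1)%N.
    rewrite -size_filter -[leqRHS](size_iota 0); apply: uniq_leq_size.
      exact: filter_uniq.
    move=> p; rewrite mem_filter mem_iota add0n ltnS /predC /above /= -leNgt.
    move=> /andP[pP _].
    by rewrite truncn_ge_nat.
  have := count_predC above ps.
  rewrite /qs size_filter -/above; move: szps; lia.
exists (take r qs); split.
- by rewrite take_uniq // filter_uniq.
- by rewrite size_takel.
move=> p /mem_take; rewrite mem_filter => /andP[Pp pps]; split=> //.
  exact: (allP prps).
apply: (le_trans (ps_le p pps)); rewrite ler_wpM2l ?(ltW C0) //.
apply: ge0_ler_powR; rewrite ?nnegrE ?addr_ge0 // ?(ltW delta_gt0) //.
have : (Num.truncn P)%:R <= P by rewrite truncn_le.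
rewrite -natr1 natrD -natr1; lra.
Qed.

(** * The auxiliary form at a nonsingular point *)

Lemma boxV_ge1 (R : realType) (n : nat) (B : 'I_n -> R) :
  (forall i, 1 <= B i) -> 1 <= boxV B.
Proof.
move=> B1; apply: (big_ind (fun z : R => 1 <= z)) => // x y; exact: mulr_ege1.
Qed.

Lemma weight_ge1 (R : realType) (n : nat) (B : 'I_n -> R) m :
  (forall i, 1 <= B i) -> 1 <= weight B m.
Proof.
move=> B1; apply: (big_ind (fun z : R => 1 <= z)) => //.
  by move=> x y; exact: mulr_ege1.
by move=> i _; exact: exprn_ege1.
Qed.

Lemma weight_le_boxV (R : realType) (n d : nat) (B : 'I_n -> R) m :
  (forall i, 1 <= B i) -> (mdeg m <= d)%N -> weight B m <= boxV B ^+ d.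
Proof.
move=> B1 md; rewrite /boxV -prodrXl; apply: ler_prod => i _.
rewrite exprn_ge0 ?(le_trans ler01) //= ler_weXn2l //.
by apply: leq_trans md; rewrite mdegE (bigD1 i) //= leq_addr.
Qed.

Lemma norm_monomial_le (R : realType) (n : nat) (B : 'I_n -> R) (x : 'I_n -> int)
    (m : 'X_{1..n}) :
  (forall i, `|(x i)%:~R| <= B i) ->
  `|(\prod_i x i ^+ m i)%:~R| <= weight B m.
Proof.
move=> xB; rewrite rmorph_prod normr_prod; apply: ler_prod => i _.
rewrite normr_ge0 rmorphXn normrX /=.
by apply: lerXn2r; rewrite ?nnegrE ?(le_trans _ (xB i)).
Qed.

Lemma eq0_of_dvd_small (R : realType) (q : nat) (z : int) :
  (q%:Z %| z)%Z -> `|z%:~R| < q%:R :> R -> z = 0.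
Proof.
move=> qz zq; apply/eqP; case: eqP => // /eqP z0.
have : (q <= `|z|)%N by rewrite dvdn_leq ?absz_gt0.
rewrite leqNgt; apply: contraNT => _; move: zq.
by rewrite -intr_norm -[`|z|%R]abszE -pmulrn ltr_nat.
Qed.

Lemma form_of_neq0 (n : nat) (I : finType) (M : I -> 'X_{1..n}) (c : I -> int) :
  injective M -> (exists i, c i != 0) -> form_of M c != 0.
Proof.
move=> Minj [i ci]; apply: contraNneq ci => /(congr1 (mcoeff (M i))).
rewrite raddf_sum mcoeff0 (bigD1 i) //= mcoeffZ mcoeffX eqxx mulr1 big1 ?addr0.
  by move=> ->.
by move=> j ji; rewrite mcoeffZ mcoeffX (inj_eq Minj) (negPf ji) mulr0.
Qed.

Lemma msupp_form_of (n : nat) (I : finType) (M : I -> 'X_{1..n}) (c : I -> int) m :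
  m \in msupp (form_of M c) -> exists i, m = M i.
Proof.
rewrite mcoeff_msupp raddf_sum /= => nz.
have [i /eqP iM|noM] := pickP (fun i => M i == m); first by exists i.
case/eqP: nz; apply: big1 => i _.
by rewrite mcoeffZ mcoeffX noM mulr0.
Qed.

(** With U = V^d / T and b = C(D+nu+1, nu+1), the product equals U^b V^(a - d b). As U, V >= 1, the
    bounds on the exponents b and a - d b carry over. *)
Lemma prod_weight_bound (R : realType) (nu d D A a : nat) (B : 'I_nu.+2 -> R)
    (f : 'X_{1..nu.+2}) (kap eta : R) :
  (forall i, 1 <= B i) -> mdeg f = d -> 
  ('C(d + D + nu.+1, nu.+2) = a + 'C(D + nu.+1, nu.+2))%N ->
  'C(D + nu.+1, nu.+1)%:R <= kap * A%:R ->
  a%:R <= d%:R * 'C(D + nu.+1, nu.+1)%:R + eta * A%:R ->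
  \prod_(m <- mons_free (d + D) f) weight B m
    <= ((boxV B ^+ d / weight B f) `^ kap * boxV B `^ eta) ^+ A.
Proof.
move=> B1 fd aE b_le a_le.
have V1 := boxV_ge1 B1; have T1 := weight_ge1 f B1.
set V := boxV B in V1 *; set T := weight B f in T1 *.
set b := 'C(D + nu.+1, nu.+1) in b_le a_le.
have V0 : 0 < V := lt_le_trans ltr01 V1.
have T0 : 0 < T := lt_le_trans ltr01 T1.
set U := V ^+ d / T.
have U1 : 1 <= U by rewrite ler_pdivlMr // mul1r /T weight_le_boxV // fd.
have U0 : 0 < U := lt_le_trans ltr01 U1.
have := prod_weight_mons_free D B fd; rewrite aE exprD -/V -/T -/b.
move/(mulIf (lt0r_neq0 (exprn_gt0 _ V0))).
set W := \prod_(m <- _) _ => WE.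
have -> : W = U ^+ b * (V ^+ a / V ^+ (d * b)).
  rewrite /U expr_div_n -exprM -WE; field; rewrite !expf_neq0 ?gt_eqF //.
rewrite [(U `^ kap * _) ^+ A]exprMn.
have nnX z k : 0 < z -> 0 <= z ^+ k :> R by move=> z0; rewrite exprn_ge0 // ltW.
apply: ler_pM; rewrite ?divr_ge0 ?nnX //.
  rewrite -[U ^+ b]powR_mulrn ?(ltW U0) // -[_ ^+ A]powR_mulrn ?powR_ge0 //.
  by rewrite -powRrM; exact: ler_powR.
rewrite ler_pdivrMr ?exprn_gt0 // -[V ^+ a]powR_mulrn ?(ltW V0) //.
rewrite -[V ^+ (d * b)]powR_mulrn ?(ltW V0) // -[(V `^ eta) ^+ A]powR_mulrn ?powR_ge0 //.
rewrite -powRrM -powRD; last by rewrite (gt_eqF V0) implybT.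
by apply: ler_powR => //; rewrite natrM addrC.
Qed.

(** The lower bound on p makes the box of coefficients exceed the number of residue vectors, while
    its sides stay small enough to force the vanishing of a value divisible by p^m. *)
Lemma local_form (R : realType) (nu d : nat) (eta : R) :
  (0 < nu)%N -> (0 < d)%N -> 0 < eta ->
  let kap : R := d%:R `^ (- (nu.+1%:R / nu%:R)) / nu%:R in
  exists D C, 0 < C /\ forall (B : 'I_nu.+2 -> R) (F : {mpoly int[nu.+2]}),
    (forall i, 1 <= B i) -> F \is d.-homog -> F != 0 ->
    forall (p : nat) (b : int) (t : 'I_nu.+2 -> int) i0 (k : 'I_nu.+1),
    C * ((boxV B ^+ d / boxT B F) `^ (kap + eta) * boxV B `^ eta) < p%:R ->
    t i0 = 1 -> (p %| b * F^`M(lift i0 k).@[t] - 1)%Z ->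
    exists G, [/\ G \is D.-homog, ~ dvdQ F G
      & forall x u, (forall i, (p %| u * x i - t i)%Z) -> F.@[x] = 0 ->
          (forall i, `|(x i)%:~R| <= B i) -> G.@[x] = 0].
Proof.
move=> nu_gt0 d_gt0 eta_gt0 kap.
have [D [m [A [a]]]] := parameters nu_gt0 d_gt0 eta_gt0.
rewrite /= -/kap; set s := (_ - _)%N; set b := 'C(_, _).
move=> [m_gt0 A_gt0 msE aE [b_le a_le]].
have s_gt0 : (0 < s)%N.
  by case: s msE => // /esym/eqP; rewrite muln0 addn_eq0; case: A A_gt0 {b_le a_le}.
(* Collects the denominators 2s of the bounds on the s coefficients. *)
pose C : R := (2 * s%:R) ^+ s.
have s1 : 1 <= s%:R :> R by rewrite ler1n.
have C1 : 1 <= C by apply: exprn_ege1; lra.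
exists (d + D)%N, C; split; first exact: lt_le_trans C1.
move=> B F B1 Fd F0 p b' t i0 k.
have B0 i : 0 < B i by apply: lt_le_trans (B1 i).
have [f [fF -> f_ndvd]] := boxT_monomial B0 F0.
have fd : mdeg f = d by apply: (dhomog_mf Fd).
set Q := _ `^ _ * _ => CQ t1 pb.
have Q1 : 0 <= Q by rewrite mulr_ge0 ?powR_ge0.
have p0 : 0 < p%:R :> R by apply: le_lt_trans CQ; rewrite mulr_ge0 // (le_trans ler01).
have p_gt0 : (0 < p)%N by rewrite ltr0n in p0.
pose E := mons_free (d + D) f.
have szE : size E = s by have := size_mons_free (n := nu.+1) D fd; rewrite -/E /s; lia.
pose M (i : 'I_s) := nth 0%MM E i.
have Minj : injective M.
  move=> i j /eqP; rewrite nth_uniq ?szE // ?filter_uniq ?mons_uniq //.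
  by move/eqP/val_inj.
have ME i : M i \in E by rewrite mem_nth // szE.
have MD i : mdeg (M i) = (d + D)%N.
  by have := ME i; rewrite mem_filter mem_mons => /andP[_ /eqP].
have w0 i : 0 < weight B (M i) by exact: weight_gt0.
(* At points of the box the s terms of the form then add up to at most p^m / 2. *)
pose K i := Num.truncn (p%:R ^+ m / (2 * s%:R * weight B (M i))).
have K_le i : (K i)%:R * weight B (M i) <= p%:R ^+ m / (2 * s%:R).
  rewrite -ler_pdivlMr // -mulrA -invfM truncn_le divr_ge0 ?exprn_ge0 //.
  by rewrite !mulr_ge0 // ltW.
have lt_pK : (\prod_(a : 'X_{1..nu < m}) p ^ (m - mdeg a) < \prod_i (K i).+1)%N.
  have -> : (\prod_(a : 'X_{1..nu < m}) p ^ (m - mdeg a) = p ^ b)%N.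
    by rewrite -expn_sum /b; case: (nu) nu_gt0 => // nu' _; rewrite sum_codeg.
  rewrite -(ltr_nat R) natrX natr_prod.
  apply: (@lt_trans _ _ (\prod_i (p%:R ^+ m / (2 * s%:R * weight B (M i))))); last first.
    apply: ltr_prod => [|i _].
      by apply/hasP; exists (Ordinal s_gt0); rewrite ?mem_index_enum.
    by rewrite truncnS_gt divr_ge0 ?exprn_ge0 ?mulr_ge0 // (ltW (w0 i)).
  (* As m s = A + b, the factor p^b cancels, and only p^A has to exceed C times the product of the
     weights. *)
  have -> : \prod_i (p%:R ^+ m / (2 * s%:R * weight B (M i)))
      = p%:R ^+ A * p%:R ^+ b / (C * \prod_(l <- E) weight B l).
    rewrite prodf_div prodr_const card_ord -exprM msE exprD big_split /=.
    rewrite prodr_const card_ord -/C; congr (_ / (_ * _)).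
    by rewrite (big_nth 0%MM) big_mkord szE.
  have WQ : \prod_(l <- E) weight B l <= Q ^+ A.
    exact: (prod_weight_bound B1 fd aE b_le a_le).
  have W0 : 0 < \prod_(l <- E) weight B l.
    by apply: prodr_gt0 => l _; exact: weight_gt0.
  have C0 : 0 < C := lt_le_trans ltr01 C1.
  rewrite ltr_pdivlMr ?mulr_gt0 // mulrC ltr_pM2r ?exprn_gt0 //.
  apply: (@le_lt_trans _ _ ((C * Q) ^+ A)).
    rewrite exprMn; apply: ler_pM => //; rewrite ?(ltW C0) ?(ltW W0) //.
    by rewrite -{1}[C]expr1 ler_weXn2l.
  by rewrite ltr_pXn2r ?nnegrE ?(mulr_ge0 (ltW C0)) ?(ltW p0).
have [c [cnz cK cP]] := local_siegel Fd MD p_gt0 m_gt0 t1 pb lt_pK.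
exists (form_of M c); split; first exact: form_of_dhomog.
- apply: f_ndvd; first exact: form_of_neq0.
  by move=> l /msupp_form_of[i ->]; have := ME i; rewrite mem_filter => /andP[].
move=> x u ut Fx xB; apply: (@eq0_of_dvd_small R (p ^ m)%N); first exact: cP Fx.
rewrite meval_form_of rmorph_sum /=; apply: le_lt_trans (ler_norm_sum _ _ _) _.
apply: (@le_lt_trans _ _ (\sum_(i < s) p%:R ^+ m / (2 * s%:R))).
  apply: ler_sum => i _; apply: le_trans (K_le i).
  rewrite rmorphM normrM ler_pM //; last exact: norm_monomial_le.
  by rewrite -intr_norm -[`|c i|%R]abszE -pmulrn ler_nat.
rewrite sumr_const card_ord -[X in X < _]mulr_natr natrX.
have pm0 : 0 < p%:R ^+ m :> R by rewrite exprn_gt0.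
have -> : p%:R ^+ m / (2 * s%:R) * s%:R = p%:R ^+ m / 2 :> R.
  by rewrite invfM mulrA mulfVK // gt_eqF // (lt_le_trans _ s1).
lra.
Qed.

(** * The forms attached to a prime *)

(** One simple root already shows that q is nonzero modulo p, and then the degree bounds the number
    of all its roots. *)
Lemma size_simple_roots (p d : nat) (q : {poly int}) :
  prime p -> (size q <= d.+1)%N ->
  (size [seq a : 'I_p <- enum 'I_p | (p %| q.[(a : nat)%:Z])%Z
                                & ~~ (p %| q^`().[(a : nat)%:Z])%Z] <= d)%N.
Proof.
move=> pr_p qd; set s := [seq a <- _ | _].
have pF := pchar_Fp pr_p.
pose red (z : int) : 'F_p := z%:~R.
have red_eq0 z : (red z == 0) = (p %| z)%Z by rewrite (dvdz_pcharf pF).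
have [->//|[a0 a0s]] : s = [::] \/ exists a, a \in s.
  by case: s => [|a s]; [left|right; exists a; exact: mem_head].
pose Q := map_poly red q.
have QE (a : int) : Q.[red a] = red q.[a] by rewrite horner_map.
have Q0 : Q != 0.
  move: a0s; rewrite mem_filter => /andP[/andP[_ nz] _]; move: nz; rewrite -red_eq0.
  apply: contraNneq => Q0.
  by rewrite -[red _]horner_map -deriv_map -/Q Q0 deriv0 horner0.
have := max_poly_roots (rs := [seq red ((a : nat)%:Z) | a : 'I_p <- s]) Q0.
rewrite size_map => H; rewrite -ltnS; apply: leq_trans qd.
apply: leq_trans (size_poly _ _); apply: H.
  apply/allP => z /mapP[a + ->]; rewrite mem_filter => /andP[/andP[pa _] _].
  by rewrite /root QE red_eq0.
rewrite map_inj_in_uniq; first exact/filter_uniq/enum_uniq.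
move=> a b _ _ /eqP.
rewrite -subr_eq0 -rmorphB red_eq0 -eqz_mod_dvd !modz_nat.
by rewrite !modn_small // eqz_nat => /eqP/val_inj.
Qed.

(** The value 0 at [lift i0 k] is a placeholder, replaced through [upd] or by the variable of
    [slice]. *)
Definition point (nu p : nat) (i0 : 'I_nu.+2) (k : 'I_nu.+1)
    (t : {ffun 'I_nu -> 'I_p}) (i : 'I_nu.+2) : int :=
  if unlift i0 i is Some l
  then if unlift k l is Some j then (t j : nat)%:Z else 0
  else 1.

Lemma seq_choice (T : eqType) (U : eqType) (P : T -> U -> Prop) (s : seq T) :
  (forall x, x \in s -> exists y, P x y) ->
  exists r : seq U, [/\ size r = size s,
    forall y, y \in r -> exists x, P x y
    & forall x, x \in s -> exists2 y, y \in r & P x y].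
Proof.
elim: s => [|x s IHs] sP; first by exists [::]; split.
have [y Pxy] := sP x (mem_head _ _).
have [|r [szr r1 r2]] := IHs; first by move=> z zs; apply: sP; rewrite inE zs orbT.
exists (y :: r); split=> [|z|z]; first by rewrite /= szr.
  by rewrite inE => /predU1P[->|/r1//]; exists x.
rewrite inE => /predU1P[->|/r2[w wr Pw]]; first by exists y; rewrite ?mem_head.
by exists w => //; rewrite inE wr orbT.
Qed.

Lemma prime_inverse (p : nat) (z : int) : prime p -> ~~ (p %| z)%Z ->
  exists u, (p %| u * z - 1)%Z.
Proof.
move=> pr_p pz.
have : coprimez p z by rewrite coprimezE absz_nat prime_coprime // -dvdzE.
case/coprimezP => -[u v] /= uv; exists v; apply/dvdzP; exists (- u).
by rewrite -uv; ring.
Qed.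

(** One form for each nonsingular point modulo p with i0-th coordinate 1: there are p^nu choices of
    the free coordinates, and for each at most d simple roots for the coordinate i1. *)
Lemma prime_forms (nu d D p : nat) (F : {mpoly int[nu.+2]})
    (i0 : 'I_nu.+2) (k : 'I_nu.+1) (X : ('I_nu.+2 -> int) -> Prop) :
  prime p -> (0 < d)%N -> F \is d.-homog ->
  (forall (b : int) (t : 'I_nu.+2 -> int),
    t i0 = 1 -> (p %| b * F^`M(lift i0 k).@[t] - 1)%Z ->
    exists G, [/\ G \is D.-homog, ~ dvdQ F G
      & forall x u, (forall i, (p %| u * x i - t i)%Z) -> F.@[x] = 0 ->
          X x -> G.@[x] = 0]) ->
  exists Gs : seq {mpoly int[nu.+2]},
    [/\ (size Gs <= p ^ nu * d)%N,
       forall G, G \in Gs -> G \is D.-homog /\ ~ dvdQ F G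
     & forall x, F.@[x] = 0 -> X x -> ~~ (p %| x i0)%Z ->
         ~~ (p %| F^`M(lift i0 k).@[x])%Z -> exists2 G, G \in Gs & G.@[x] = 0].
Proof.
move=> pr_p d_gt0 Fd HG; set i1 := lift i0 k.
pose tv (s : {ffun 'I_nu -> 'I_p} * 'I_p) := upd i1 (point i0 k s.1) ((s.2 : nat)%:Z).
pose roots (t : {ffun 'I_nu -> 'I_p}) := [seq a : 'I_p <- enum 'I_p |
   (p %| (slice i1 (point i0 k t) F).[(a : nat)%:Z])%Z
   & ~~ (p %| (slice i1 (point i0 k t) F)^`().[(a : nat)%:Z])%Z].
pose T := [seq (t, a) | t <- enum {ffun 'I_nu -> 'I_p}, a <- roots t].
have szT : (size T <= p ^ nu * d)%N.
  rewrite size_allpairs_dep sumnE big_map.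
  apply: (@leq_trans (\sum_(t <- enum {ffun 'I_nu -> 'I_p}) d)%N).
    apply: leq_sum => t _; apply: size_simple_roots => //; exact: size_slice.
  by rewrite big_const_seq count_predT iter_addn_0 -cardE card_ffun !card_ord mulnC.
have [|Gs [szGs Gs1 Gs2]] := @seq_choice _ _ (fun s G => [/\ G \is D.-homog, ~ dvdQ F G
      & forall x u, (forall i, (p %| u * x i - tv s i)%Z) -> F.@[x] = 0 ->
          X x -> G.@[x] = 0]) T.
  move=> [t a] /allpairsPdep[t' [a' [_ a'r [-> ->]]]].
  move: a'r; rewrite mem_filter => /andP[/andP[_]].
  rewrite deriv_slice horner_slice => /(prime_inverse pr_p)[b pb] _.
  apply: (HG b) => //.
  by rewrite /tv /upd /= (negPf (neq_lift _ _)) /point unlift_none.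
exists Gs; split=> [|G /Gs1[s []]|x Fx Xx xi0 dFx] //; first by rewrite szGs.
have [u ux] := prime_inverse pr_p xi0.
have p0 : (p : int) != 0 by rewrite eqz_nat -lt0n prime_gt0.
have lt_mod z : (`|(z %% p)%Z| < p)%N.
  by rewrite -ltz_nat gez0_abs ?modz_ge0 // ltz_mod.
pose res z : 'I_p := Ordinal (lt_mod z).
have resP z : (p %| z - (res z : nat)%:Z)%Z.
  by rewrite -eqz_mod_dvd /= gez0_abs ?modz_ge0 // modz_mod.
pose t := [ffun j => res (u * x (emb i0 k j))].
pose a := res (u * x i1).
have tvP i : (p %| u * x i - tv (t, a) i)%Z.
  rewrite /tv /upd /=; case: eqP => [->|/eqP ne]; first exact: resP.
  rewrite /point; case: unliftP => [l il|->//].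
  case: unliftP => [j lj|lk]; last by rewrite il lk eqxx in ne.
  by rewrite ffunE il lj; exact: resP.
(* The derivative at u x is a power of u times that at x, so its nonvanishing modulo p passes to the
   reduced point because u is a unit. *)
have pu : ~~ (p %| u)%Z.
  apply/negP => pu; have : (p%:Z %| 1%:Z)%Z.
    have -> : 1%:Z = u * x i0 - (u * x i0 - 1) by ring.
    by rewrite rpredB // dvdz_mulr.
  by rewrite dvdz1 /= => /eqP p1; rewrite p1 in pr_p.
have /Gs2[G GGs [_ _ GP]] : (t, a) \in T.
  apply/allpairsPdep; exists t, a; split; rewrite ?mem_enum //.
  rewrite mem_filter mem_enum andbT deriv_slice !horner_slice -/(tv (t, a)).
  have cong (H : {mpoly int[nu.+2]}) e : H \is e.-homog ->
      (p %| u ^+ e * H.@[x] - H.@[tv (t, a)])%Z.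
    by move=> He; rewrite -(meval_dhomog _ _ He); exact: meval_cong.
  apply/andP; split.
    by have := cong _ _ Fd; rewrite Fx mulr0 sub0r rpredN.
  move: d_gt0 Fd; case: (d) => // e _ Fd; apply/negP => pdF.
  have := cong _ _ (mderiv_dhomog i1 Fd) => /rpredD/(_ pdF); rewrite subrK.
  move: dFx pu; rewrite !dvdzE absz_nat => ndF npu.
  by rewrite abszM Euclid_dvdM // (negPf ndF) orbF abszX Euclid_dvdX // (negPf npu).
by exists G => //; exact: GP tvP Fx Xx.
Qed.

(** * The covering family *)

Lemma Zprim_prime (n p : nat) (x : 'I_n -> int) : prime p -> Zprim x ->
  exists i, ~~ (p %| x i)%Z.
Proof.
move=> pr_p [_ gx _]; have [i pi|allp] := pickP (fun i => ~~ (p %| x i)%Z).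
  by exists i.
have : (p %| \big[gcdz/0]_(i < n) x i)%Z.
  apply: (big_ind (fun z => (p %| z)%Z)) => [|a b pa pb|i _]; first exact: dvdz0.
    by rewrite dvdz_gcd pa.
  exact: negbFE (allp i).
by rewrite gx dvdz1 /= => /eqP p1; rewrite p1 in pr_p.
Qed.

(** Euler's identity: if p divided all derivatives other than the i0-th, it would divide x_i0 times
    that one, hence that one too. *)
Lemma nonsingular_index (nu d p : nat) (F : {mpoly int[nu.+2]}) x i0 :
  prime p -> F \is d.-homog -> F.@[x] = 0 -> ~~ (p %| x i0)%Z ->
  (exists i, ~~ (p %| F^`M(i).@[x])%Z) ->
  exists k : 'I_nu.+1, ~~ (p %| F^`M(lift i0 k).@[x])%Z.
Proof.
move=> pr_p Fd Fx xi0 [i pi].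
have [k pk|allp] := pickP (fun k => ~~ (p %| F^`M(lift i0 k).@[x])%Z).
  by exists k.
have {}allp k : (p %| F^`M(lift i0 k).@[x])%Z by exact: negbFE (allp k).
case/negP: pi; case: (unliftP i0 i) => [k ->|->]; first exact: allp.
have := euler_dhomog x Fd; rewrite Fx mulr0 (bigD1 i0) //= => /eqP.
rewrite addr_eq0 => /eqP E.
have : (p %| x i0 * F^`M(i0).@[x])%Z.
  rewrite E rpredN; apply: rpred_sum => j.
  case: (unliftP i0 j) => [k ->|->]; last by rewrite eqxx.
  by move=> _; apply/dvdz_mull/allp.
by rewrite Gauss_dvdzr // coprimezE absz_nat prime_coprime // -dvdzE.
Qed.

Lemma exp2_le_of_primes (ps : seq nat) (N : nat) : uniq ps -> (0 < N)%N ->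
  (forall p, p \in ps -> prime p && (p %| N)%N) -> (2 ^ size ps <= N)%N.
Proof.
elim: ps N => [|p ps IHps] N /=; first by rewrite expn0.
move=> /andP[pNps ups] N0 H.
have /andP[pr_p pN] := H p (mem_head _ _).
have [q NE] := dvdnP pN; rewrite NE in N0 H *.
have q0 : (0 < q)%N by move: N0; rewrite muln_gt0 => /andP[].
rewrite expnSr; apply: leq_mul; last exact: prime_gt1.
apply: IHps => // l lps.
have /andP[pr_l] : prime l && (l %| q * p)%N by apply: H; rewrite inE lps orbT.
rewrite pr_l Euclid_dvdM // (dvdn_prime2 pr_l pr_p) => /orP[->//|/eqP lp].
by rewrite -lp lps in pNps.
Qed.

(** A crude estimate suffices, since only its logarithm enters the number of primes. *)
Lemma mderiv_bound (R : realType) (n d : nat) (F : {mpoly int[n]}) (B : 'I_n -> R)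
    (x : 'I_n -> int) (i : 'I_n) :
  (forall i, 1 <= B i) -> F \is d.-homog -> (forall i, `|(x i)%:~R| <= B i) ->
  `|(F^`M(i).@[x])%:~R| <= (size (mons n d) * d * mpoly_norm F)%:R * boxV B ^+ d.
Proof.
move=> B1 /dhomogP Fd xB.
have -> : F^`M(i).@[x] = \sum_(m <- msupp F)
    F@_m * (m i)%:Z * \prod_j x j ^+ (m - U_(i))%MM j.
  rewrite {1}[F]mpolyE (linear_sum (mderiv i)) (raddf_sum (meval x)).
  apply: eq_bigr => m _ /=.
  by rewrite mderivZ mderivX !mevalZ mevalX mulrA natz.
rewrite rmorph_sum /=; apply: le_trans (ler_norm_sum _ _ _) _.
have V0 : 0 <= boxV B := le_trans ler01 (boxV_ge1 B1).
apply: (@le_trans _ _ (\sum_(m <- msupp F) (d * mpoly_norm F)%:R * boxV B ^+ d)).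
  rewrite big_seq [leRHS]big_seq; apply: ler_sum => m mF.
  have md : mdeg m = d := Fd m mF.
  have wV : weight B (m - U_(i))%MM <= boxV B ^+ d.
    by apply: weight_le_boxV => //; rewrite -md mdegB.
  rewrite rmorphM normrM; apply: ler_pM => //; last first.
    by apply: le_trans wV; exact: norm_monomial_le.
  rewrite -intr_norm -abszE -pmulrn ler_nat abszM mulnC; apply: leq_mul.
    by rewrite absz_nat -md mdegE (bigD1 i) //= leq_addr.
  exact: (@leq_bigmax_seq _ (msupp F) xpredT (fun m => `|F@_m|%N)).
rewrite big_const_seq count_predT iter_addr_0 -mulrnAl -mulr_natl -natrM.
rewrite ler_wpM2r ?exprn_ge0 // ler_nat -mulnA leq_mul2r; apply/orP; right.
apply: uniq_leq_size (msupp_uniq _) _ => m mF.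
by rewrite mem_mons; apply/eqP/Fd.
Qed.

Lemma mderiv_neq0 (n d : nat) (F : {mpoly int[n]}) :
  (0 < d)%N -> F != 0 -> F \is d.-homog -> exists i, F^`M(i) != 0.
Proof.
move=> d_gt0 F0 /dhomogP Fd; have mF := mlead_supp F0.
have : mdeg (mlead F) != 0%N by rewrite -lt0n [mdeg _](Fd _ mF).
rewrite mdegE sum_nat_eq0 negb_forall => /existsP[i /= mi]; exists i.
apply: contraNneq F0 => /(congr1 (mcoeff (mlead F - U_(i))%MM)).
rewrite mcoeff_mderiv mcoeff0 submK ?lep1mP //.
by move/eqP; rewrite mulrn_eq0 /= mleadc_eq0.
Qed.

(** A form of degree 0 is a constant, over Q either zero or a unit. *)
Lemma irreducible_deg_gt0 (n d : nat) (F : {mpoly int[n]}) :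
  F \is d.-homog -> irreducible_elt (toQ F) -> F != 0 /\ (0 < d)%N.
Proof.
move=> Fd [F0 Fu _]; split.
  by apply: contraNneq F0 => ->; rewrite /toQ rmorph0.
case: d Fd => // /dhomogP Fd; case/negP: Fu.
have E : toQ F = ((toQ F)@_0)%:MP.
  apply/mpolyP => m; rewrite mcoeffC; case: eqP => [->|/eqP m0]; first by rewrite mulr1.
  rewrite mulr0; apply: memN_msupp_eq0; rewrite msupp_toQ; apply: contra m0.
  by move/Fd => /eqP; rewrite mdeg_eq0.
rewrite unfold_in /= /mpoly_unit -E eqxx /= unitfE.
by apply: contraNneq F0 => c0; rewrite E c0.
Qed.

(** The first nu+2 forms are the nonzero derivatives, for the points where all derivatives vanish.
    The others come from [prime_forms], once for each prime and each ordered pair of distinct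
    coordinates. *)
Lemma cover_forms (R : realType) (nu d D q : nat) (F : {mpoly int[nu.+2]})
    (X : ('I_nu.+2 -> int) -> Prop) (ps : seq nat) :
  (0 < d)%N -> F \is d.-homog -> F != 0 -> uniq ps ->
  (forall p, p \in ps -> prime p /\ (p <= q)%N) ->
  (forall x i, X x -> F^`M(i).@[x] != 0 -> (`|F^`M(i).@[x]| < 2 ^ size ps)%N) ->
  (forall p i0 k (b : int) (t : 'I_nu.+2 -> int), p \in ps ->
    t i0 = 1 -> (p %| b * F^`M(lift i0 k).@[t] - 1)%Z ->
    exists G, [/\ G \is D.-homog, ~ dvdQ F G
      & forall x u, (forall i, (p %| u * x i - t i)%Z) -> F.@[x] = 0 ->
          X x -> G.@[x] = 0]) ->
  exists Gs : seq {mpoly int[nu.+2]},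
    [/\ (size Gs <= nu.+2 + size ps * (nu.+2 * nu.+1) * (q ^ nu * d))%N,
       forall G, G \in Gs ->
         (exists2 e, (e <= maxn d D)%N & G \is e.-homog) /\ ~ dvdQ F G
     & forall x, F.@[x] = 0 -> Zprim x -> X x -> exists2 G, G \in Gs & G.@[x] = 0].
Proof.
move=> d_gt0 Fd F0 ups psP XF HG.
pose T := [seq (p, ik) | p <- ps, ik <- enum {: 'I_nu.+2 * 'I_nu.+1}].
have szT : size T = (size ps * (nu.+2 * nu.+1))%N.
  by rewrite size_allpairs -cardE card_prod !card_ord.
have [|Gss [szGss Gss1 Gss2]] := @seq_choice _ _
  (fun (a : nat * ('I_nu.+2 * 'I_nu.+1)) Gs =>
   [/\ (size Gs <= q ^ nu * d)%N,
       forall G, G \in Gs -> G \is D.-homog /\ ~ dvdQ F G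
     & forall x, F.@[x] = 0 -> X x -> ~~ (a.1 %| x a.2.1)%Z ->
         ~~ (a.1 %| F^`M(lift a.2.1 a.2.2).@[x])%Z ->
         exists2 G, G \in Gs & G.@[x] = 0]) T.
  move=> a /allpairsP[[p [i0 k]] /= [pps _ ->]] /=.
  have [pr_p pq] := psP p pps.
  have [Gs [szGs Gs1 Gs2]] := prime_forms pr_p d_gt0 Fd
    (fun b t => @HG p i0 k b t pps).
  exists Gs; split=> //; apply: (leq_trans szGs).
  rewrite leq_mul2r; case: (posnP nu) => [->|nu_gt0]; first by rewrite orbT.
  by rewrite leq_exp2r // pq orbT.
pose Ds := [seq F^`M(i) | i <- enum 'I_nu.+2 & F^`M(i) != 0].
exists (Ds ++ flatten Gss); split.
- rewrite size_cat leq_add //.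
    by rewrite size_map size_filter (leq_trans (count_size _ _)) // size_enum_ord.
  rewrite size_flatten sumnE big_map -szT -szGss.
  apply: (@leq_trans (\sum_(r <- Gss) q ^ nu * d)%N).
    by rewrite [leqLHS]big_seq [leqRHS]big_seq; apply: leq_sum => r /Gss1[a []].
  by rewrite big_const_seq count_predT iter_addn_0 mulnC.
- move=> G; rewrite mem_cat => /orP[/mapP[i]|/flattenP[Gs /Gss1[a [_ H _]] /H[Gd Gn]]].
    rewrite mem_filter => /andP[dF0 _] ->.
    move: d_gt0 Fd; case: (d) => // e _ Fd; split; last exact: (ndvdQ_mderiv Fd dF0).
    by exists e; [rewrite leq_max leqnSn|exact: mderiv_dhomog].
  by split=> //; exists D => //; rewrite leq_maxr.
move=> x Fx xprim Xx.
have [i di|alld] := pickP (fun i => F^`M(i).@[x] != 0); last first.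
  have [i Fi] := mderiv_neq0 d_gt0 F0 Fd.
  exists F^`M(i); last by apply/eqP/negbFE; exact: alld.
  by rewrite mem_cat; apply/orP; left; apply: map_f; rewrite mem_filter Fi mem_enum.
(* Otherwise all primes of [ps] divide a nonzero value, which is then at least 2 to the number of
   primes. *)
have /hasP[p pps pi] : has (fun p : nat => ~~ (p %| F^`M(i).@[x])%Z) ps.
  rewrite has_predC; apply/negP => /allP allp.
  have := XF x i Xx di; rewrite ltnNge exp2_le_of_primes ?absz_gt0 // => p pps.
  by have [-> _] := psP p pps; have := allp p pps; rewrite /= dvdzE absz_nat.
have [pr_p pq] := psP p pps.
have [i0 xi0] := Zprim_prime pr_p xprim.
have [k xk] := nonsingular_index pr_p Fd Fx xi0 (ex_intro _ i pi).
have /Gss2[Gs GsG [_ _ /(_ x Fx Xx xi0 xk)[G GG Gx]]] : (p, (i0, k)) \in T.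
  by apply/allpairsP; exists (p, (i0, k)); rewrite mem_enum.
by exists G => //; rewrite mem_cat; apply/orP; right; apply/flattenP; exists Gs.
Qed.

(** * Final estimates *)

Lemma powR_ge1 (R : realType) (a x : R) : 1 <= a -> 0 <= x -> 1 <= a `^ x.
Proof. by move=> a1 x0; rewrite -[leLHS](powRr0 a) ler_powR. Qed.

Lemma ln_le_powR (R : realType) (x e : R) : 0 < x -> 0 < e -> ln x <= x `^ e / e.
Proof.
move=> x0 e0; rewrite ler_pdivlMr // mulrC -ln_powR.
by apply/ltW/ln_sublinear/powR_gt0.
Qed.

Lemma prime_count_bound (R : realType) (c d : nat) (eta : R) :
  (0 < c)%N -> 0 < eta ->
  exists2 C : R, 0 < C & forall (V : R) (N : nat), 1 <= V -> (0 < N)%N ->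
    exists2 r : nat, r%:R <= C * Num.max 1 (ln N%:R) * V `^ eta
      & (c * N)%:R * V ^+ d < 2 ^+ r.
Proof.
move=> c0 eta0; have ln2 : 0 < ln 2%:R :> R by rewrite ln_gt0 // ltr1n.
have lnc : 0 <= ln c%:R :> R by rewrite ln_ge0 // ler1n.
(* The three summands come from ln c, ln N and d ln V, the last by ln V <= V^eta / eta; the final 1
   is for rounding r up. *)
pose C : R := (ln c%:R + 1 + d%:R / eta) / ln 2%:R + 1.
have C0 : 0 < C.
  have de : 0 <= d%:R / eta by rewrite divr_ge0 // ltW.
  by rewrite addr_gt0 // divr_gt0 //; lra.
exists C => // V N V1 N0; set L := Num.max _ _.
have L1 : 1 <= L by rewrite le_max lexx.
have LN : ln N%:R <= L by rewrite le_max lexx orbT.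
have V0 : 0 < V := lt_le_trans ltr01 V1.
have Ve1 : 1 <= V `^ eta by rewrite powR_ge1 // ltW.
pose W : R := (c * N)%:R * V ^+ d.
have W0 : 0 < W by rewrite mulr_gt0 ?exprn_gt0 // ltr0n muln_gt0 c0.
have lnW : ln W = ln c%:R + ln N%:R + d%:R * ln V.
  rewrite /W lnM ?posrE ?exprn_gt0 ?ltr0n ?muln_gt0 ?c0 // natrM.
  by rewrite lnM ?posrE ?ltr0n // lnXn // mulr_natl.
have W1 : 1 <= W.
  by rewrite mulr_ege1 ?exprn_ege1 // ler1n muln_gt0 c0.
have lnW0 : 0 <= ln W by exact: ln_ge0.
exists (Num.truncn (ln W / ln 2%:R)).+1; last first.
  rewrite -/W -ltr_ln ?posrE ?exprn_gt0 // lnXn // -[ltRHS]mulr_natl.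
  by rewrite -ltr_pdivrMr // truncnS_gt.
have LV1 : 1 <= L * V `^ eta by exact: mulr_ege1.
have lnWb : ln W <= (ln c%:R + 1 + d%:R / eta) * (L * V `^ eta).
  rewrite lnW !mulrDl mul1r; apply: lerD; first apply: lerD.
  - by rewrite ler_peMr.
  - by apply: (le_trans LN); rewrite ler_peMr // (le_trans ler01).
  - rewrite -mulrA ler_wpM2l // mulrC.
    apply: (le_trans (ln_le_powR V0 eta0)).
    by rewrite ler_wpM2r ?invr_ge0 ?(ltW eta0) // ler_peMl // powR_ge0.
rewrite -natr1 -mulrA /C mulrDl mul1r; apply: lerD => //.
have -> : forall a b z : R, a / b * z = a * z / b by move=> *; rewrite mulrAC.
have : (Num.truncn (ln W / ln 2%:R))%:R <= ln W / ln 2%:R.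
  by rewrite truncn_le divr_ge0 // ltW.
move=> /le_trans; apply; by rewrite ler_wpM2r // invr_ge0 ltW.
Qed.

(** Up to constants, Y = U^kap V^g L bounds both the number r of primes and the threshold on their
    size, so q is at most of order Y^(1+eta). Surplus powers of U are absorbed into V by U <= V^d.
    The exponent of L is 1 from r and at most 2 nu from q^nu. *)
Lemma final_bound (R : realType) (nu d : nat) (kap eta eps C2 C3 Cp c1 c2 : R) :
  0 <= kap -> 0 < eta -> eta <= 1 -> 0 < C2 -> 0 < C3 -> 0 < Cp -> 0 <= c1 -> 0 <= c2 ->
  eta * (1 + d%:R * (kap * nu%:R) + 2 * (d%:R + 1) * nu%:R) <= eps ->
  exists2 C : R, 0 < C & forall (U V L r q : R), 1 <= U -> 1 <= V -> 1 <= L ->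
    U <= V ^+ d -> 0 <= r -> r <= C2 * L * V `^ eta ->
    0 <= q -> q <= Cp * (r + C3 * (U `^ (kap + eta) * V `^ eta) + 2) `^ (1 + eta) ->
    c1 + c2 * r * q ^+ nu
      <= C * U `^ (kap * nu%:R) * V `^ eps * L ^+ (2 * nu).+1.
Proof.
move=> kap0 eta0 eta1 C20 C30 Cp0 c10 c20 eps_ge.
pose C5 := C2 + C3 + 2; have C50 : 0 < C5 by rewrite !addr_gt0.
pose K := Cp ^+ nu * C5 `^ ((1 + eta) * nu%:R).
have K0 : 0 < K by rewrite mulr_gt0 ?exprn_gt0 ?powR_gt0.
exists (c1 + c2 * C2 * K + 1) => [|U V L r q U1 V1 L1 UV r0 r_le q0 q_le].
  by have := mulr_ge0 (mulr_ge0 c20 (ltW C20)) (ltW K0); lra.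
have U0 : 0 < U := lt_le_trans ltr01 U1.
have V0 : 0 < V := lt_le_trans ltr01 V1.
have L0 : 0 < L := lt_le_trans ltr01 L1.
have UVe : U `^ eta <= V `^ (d%:R * eta).
  rewrite powRrM powR_mulrn ?(ltW V0) //; apply: ge0_ler_powR => //; first exact: ltW.
  - exact: ltW.
  - by rewrite nnegrE exprn_ge0 // ltW.
have pU x : 0 <= x -> 1 <= U `^ x by exact: powR_ge1.
have pV x : 0 <= x -> 1 <= V `^ x by exact: powR_ge1.
(* The part d eta absorbs U^eta, the part eta is the factor V^eta. *)
pose g := (d%:R + 1) * eta; have g0 : 0 <= g by rewrite mulr_ge0 ?addr_ge0 // ltW.
pose Y := U `^ kap * V `^ g * L.
have Y1 : 1 <= Y by rewrite !mulr_ege1 ?pU ?pV.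
have Y0 : 0 < Y := lt_le_trans ltr01 Y1.
have eg : eta <= g by rewrite /g mulrDl mul1r lerDr mulr_ge0 // ltW.
have rY : r <= C2 * Y.
  apply: (le_trans r_le); rewrite -mulrA ler_pM2l // /Y [leRHS]mulrC ler_pM2l //.
  apply: (@le_trans _ _ (V `^ g)); first exact: ler_powR.
  by rewrite ler_peMl ?powR_ge0 ?pU.
have PY : C3 * (U `^ (kap + eta) * V `^ eta) <= C3 * Y.
  rewrite ler_pM2l //; apply: (@le_trans _ _ (U `^ kap * V `^ g)); last first.
    by rewrite /Y ler_peMr // mulr_ge0 ?powR_ge0.
  rewrite powRD; last by rewrite (gt_eqF U0) implybT.
  rewrite -mulrA ler_pM2l ?powR_gt0 // /g mulrDl mul1r powRD; last first.
    by rewrite (gt_eqF V0) implybT.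
  by rewrite ler_wpM2r ?powR_ge0.
have sumY : r + C3 * (U `^ (kap + eta) * V `^ eta) + 2 <= C5 * Y.
  rewrite /C5; lra.
have e1 : 0 <= 1 + eta by rewrite addr_ge0 // ltW.
have q_le2 : q <= Cp * (C5 * Y) `^ (1 + eta).
  apply: (le_trans q_le); rewrite ler_pM2l //; apply: ge0_ler_powR => //.
  - by rewrite nnegrE !addr_ge0 // ?mulr_ge0 ?powR_ge0 // ltW.
  - by rewrite nnegrE mulr_ge0 // ltW.
have qn : q ^+ nu <= K * Y `^ ((1 + eta) * nu%:R).
  apply: (@le_trans _ _ ((Cp * (C5 * Y) `^ (1 + eta)) ^+ nu)).
    by apply: lerXn2r; rewrite ?nnegrE // mulr_ge0 ?powR_ge0 // ltW.
  rewrite exprMn -[_ ^+ nu in X in _ * X]powR_mulrn ?powR_ge0 // -powRrM.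
  by rewrite powRM ?(ltW C50) ?(ltW Y0) // mulrA.
set h := (1 + eta) * nu%:R in qn *.
have h0 : 0 <= h by rewrite mulr_ge0.
have hE : h = nu%:R + eta * nu%:R by rewrite /h mulrDl mul1r.
have h2 : h <= (2 * nu)%:R.
  rewrite hE natrM mulr_natl mulr2n lerD2l; by rewrite ler_piMl.
have Yh : Y `^ h <= U `^ (kap * nu%:R)
    * V `^ (d%:R * (kap * nu%:R) * eta + 2 * nu%:R * g) * L ^+ (2 * nu).
  rewrite /Y !powRM ?mulr_ge0 ?powR_ge0 ?(ltW L0) //.
  apply: ler_pM; rewrite ?mulr_ge0 ?powR_ge0 //; last first.
    by rewrite -powR_mulrn ?(ltW L0) //; exact: ler_powR.
  rewrite -!powRrM hE mulrDr powRD; last by rewrite (gt_eqF U0) implybT.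
  rewrite -mulrA ler_pM2l ?powR_gt0 //.
  rewrite powRD; last by rewrite (gt_eqF V0) implybT.
  apply: ler_pM; rewrite ?powR_ge0 //.
    have -> : kap * (eta * nu%:R) = eta * (kap * nu%:R) by ring.
    have -> : d%:R * (kap * nu%:R) * eta = (d%:R * eta) * (kap * nu%:R) by ring.
    rewrite powRrM [leRHS]powRrM; apply: ge0_ler_powR; rewrite ?nnegrE ?powR_ge0 //.
    by rewrite mulr_ge0.
  apply: ler_powR => //; rewrite -hE mulrC ler_wpM2r //.
  by move: h2; rewrite natrM.
set E := d%:R * _ * eta + _ in Yh.
have main : r * q ^+ nu <= C2 * K * (U `^ (kap * nu%:R) * V `^ eps * L ^+ (2 * nu).+1).
  apply: (@le_trans _ _ ((C2 * L * V `^ eta)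
      * (K * (U `^ (kap * nu%:R) * V `^ E * L ^+ (2 * nu))))).
    apply: ler_pM; rewrite ?exprn_ge0 //.
    by apply: (le_trans qn); rewrite ler_pM2l.
  have -> : C2 * L * V `^ eta * (K * (U `^ (kap * nu%:R) * V `^ E * L ^+ (2 * nu)))
     = C2 * K * (U `^ (kap * nu%:R) * (V `^ eta * V `^ E) * L ^+ (2 * nu).+1).
    by rewrite exprS; ring.
  rewrite -powRD; last by rewrite (gt_eqF V0) implybT.
  rewrite ler_pM2l ?(mulr_gt0 C20 K0) // ler_pM2r ?exprn_gt0 // ler_pM2l ?powR_gt0 //.
  apply: ler_powR => //; apply: le_trans eps_ge; rewrite /E /g; lra.
set Z := U `^ (kap * nu%:R) * V `^ eps * L ^+ (2 * nu).+1 in main *.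
have Z1 : 1 <= Z.
  rewrite !mulr_ege1 ?exprn_ege1 ?pU ?mulr_ge0 // pV //.
  apply: le_trans eps_ge; rewrite mulr_ge0 ?(ltW eta0) // !addr_ge0 ?mulr_ge0 //.
  by rewrite addr_ge0.
have -> : (c1 + c2 * C2 * K + 1) * U `^ (kap * nu%:R) * V `^ eps * L ^+ (2 * nu).+1
   = (c1 + c2 * C2 * K + 1) * Z by rewrite /Z !mulrA.
have := ler_wpM2l c20 main.
have : c1 <= c1 * Z by rewrite ler_peMr.
rewrite -mulrA !mulrDl; lra.
Qed.

Lemma mpoly_norm_gt0 (n : nat) (F : {mpoly int[n]}) : F != 0 -> (0 < mpoly_norm F)%N.
Proof.
move=> /mlead_supp mF.
apply: leq_trans (@leq_bigmax_seq _ (msupp F) xpredT (fun m => `|F@_m|%N) _ mF isT).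
by rewrite absz_gt0 -mcoeff_msupp.
Qed.

Theorem theorem14 (R : realType) (n d : nat) (hn : (3 <= n)%N)
    (eps : R) (heps : 0 < eps) :
  exists (D : nat) (C : R), 0 < C /\
    forall (B : 'I_n -> R) (F : {mpoly int[n]}),
      (forall i, 1 <= B i) ->
      F \is d.-homog ->
      irreducible_elt (toQ F) ->
      exists (k : nat) (Fj : 'I_k -> {mpoly int[n]}),
        [/\ k%:R <= C
              * (boxV B ^+ d / boxT B F)
                  `^ (d%:R `^ (- ((n%:R - 1) / (n%:R - 2))))
              * boxV B `^ eps
              * log_norm R F ^+ (2 * n - 3),
            forall j, exists2 e : nat, (e <= D)%N & Fj j \is e.-homog,
            forall j, ~ dvdQ F (Fj j)
          & forall x : 'I_n -> int,
              Zprim x -> F.@[x] = 0 ->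
              (forall i, `|(x i)%:~R| <= B i) ->
              exists j, (Fj j).@[x] = 0].
Proof.
have [nu nu_gt0 ->] : exists2 nu, (0 < nu)%N & n = nu.+2.
  by case: n hn => [|[|[|nu]]] // _; exists nu.+1.
have [d0|d_gt0] := posnP d.
  exists 0%N, 1; split=> // B F _ Fd irr.
  by have [_] := irreducible_deg_gt0 Fd irr; rewrite d0.
have -> : nu.+2%:R - 1 = nu.+1%:R :> R by rewrite -[nu.+2%:R]natr1 addrK.
have -> : nu.+2%:R - 2 = nu%:R :> R by rewrite -addn2 natrD addrK.
have -> : (2 * nu.+2 - 3 = (2 * nu).+1)%N by lia.
have nuR : 0 < nu%:R :> R by rewrite ltr0n.
pose kap : R := d%:R `^ (- (nu.+1%:R / nu%:R)) / nu%:R.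
have kap0 : 0 <= kap by rewrite divr_ge0 ?powR_ge0.
(* The exponent of the theorem is kap nu, because a prime of size about U^kap yields of the order of
   p^nu forms. *)
have -> : d%:R `^ (- (nu.+1%:R / nu%:R)) = kap * nu%:R.
  by rewrite /kap mulfVK // gt_eqF.
(* The exponent of V spent per unit of [eta] in [final_bound]; the minimum with 1 below keeps (1 +
   eta) nu within 2 nu. *)
pose M : R := 1 + d%:R * (kap * nu%:R) + 2 * (d%:R + 1) * nu%:R.
have M0 : 0 < M.
  have m1 : 0 <= d%:R * (kap * nu%:R) := mulr_ge0 (ler0n _ _) (mulr_ge0 kap0 (ler0n _ _)).
  have m2 : 0 <= 2 * (d%:R + 1) * nu%:R :> R by rewrite natr1 -!natrM ler0n.
  by rewrite /M; lra.
pose eta := Num.min 1 (eps / M).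
have eta0 : 0 < eta by rewrite lt_min ltr01 divr_gt0.
have eta1 : eta <= 1 by rewrite ge_min lexx.
have etaM : eta * M <= eps by rewrite -ler_pdivlMr // ge_min lexx orbT.
have c_gt0 : (0 < size (mons nu.+2 d) * d)%N.
  by rewrite muln_gt0 d_gt0 size_mons bin_gt0 leq_addl.
have [D [C3 [C30 HF]]] := local_form nu_gt0 d_gt0 eta0.
have [Cp Cp0 HP] := primes_above eta0.
have [C2 C20 HR] := @prime_count_bound R _ d eta c_gt0 eta0.
have [C C0 HC] := @final_bound R nu d kap eta eps C2 C3 Cp nu.+2%:R
  (nu.+2 * nu.+1 * d)%:R kap0 eta0 eta1 C20 C30 Cp0 (ler0n _ _) (ler0n _ _) etaM.
exists (maxn d D), C; split=> // B F B1 Fd irr.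
have [F0 _] := irreducible_deg_gt0 Fd irr.
have B0 i : 0 < B i := lt_le_trans ltr01 (B1 i).
have V1 := boxV_ge1 B1; set V := boxV B in V1 *.
have UT : 1 <= V ^+ d / boxT B F <= V ^+ d.
  have [f [fF -> _]] := boxT_monomial B0 F0.
  have f0 := weight_gt0 f B0; have f1 := weight_ge1 f B1.
  rewrite ler_pdivlMr // mul1r ler_pdivrMr //.
  rewrite ler_peMr ?exprn_ge0 ?(le_trans ler01) // andbT.
  by apply: weight_le_boxV => //; rewrite [mdeg f](dhomog_mf Fd fF).
have {UT}/andP[U1 UV] := UT; set U := V ^+ d / _ in U1 UV *.
have N0 := mpoly_norm_gt0 F0.
have [r r_le Wr] := HR V (mpoly_norm F) V1 N0.
(* The threshold of [local_form]: above it, one form serves each nonsingular residue class. *)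
pose P := C3 * (U `^ (kap + eta) * V `^ eta).
have P0 : 0 <= P by rewrite !mulr_ge0 ?powR_ge0 // ltW.
have [ps [ups szps psP]] := HP P r P0.
set Q := Cp * _ in psP; have Q0 : 0 <= Q by rewrite mulr_ge0 ?powR_ge0 // ltW.
pose q := Num.truncn Q.
pose X (x : 'I_nu.+2 -> int) := forall i, `|(x i)%:~R| <= B i.
have [|||Gs [szGs GsP GsX]] := @cover_forms R nu d D q F X ps d_gt0 Fd F0 ups.
- by move=> p /psP[pr_p _ pQ]; split=> //; rewrite truncn_ge_nat.
- move=> x i Xx _; rewrite szps -(ltr_nat R) natrX; apply: le_lt_trans Wr.
  by have := mderiv_bound i B1 Fd Xx; rewrite -intr_norm -abszE -pmulrn.
- move=> p i0 k b t /psP[pr_p Pp _]; exact: HF.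
exists (size Gs), (fun j => tnth (in_tuple Gs) j); split.
- have L1 : 1 <= log_norm R F by rewrite le_max lexx.
  have Q_le : q%:R <= Q by rewrite truncn_le.
  apply: le_trans
    (HC U V (log_norm R F) r%:R q%:R U1 V1 L1 UV (ler0n _ _) r_le (ler0n _ _) Q_le).
  apply: (@le_trans _ _ (nu.+2 + size ps * (nu.+2 * nu.+1) * (q ^ nu * d))%:R).
    by rewrite ler_nat.
  rewrite szps !(natrD, natrM, natrX); lra.
- by move=> j; have [] := GsP _ (mem_tnth j (in_tuple Gs)).
- by move=> j; have [] := GsP _ (mem_tnth j (in_tuple Gs)).
move=> x xprim Fx Xx; have [G /(nthP 0)[j jG <-] Gx] := GsX x Fx xprim Xx.
by exists (Ordinal jG); rewrite (tnth_nth 0).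
Qed.
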